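(* Let $\phi$ be a windowed timed CEL formula. Then there exists a timed CEA $\mathcal{T}$ with two clocks that has synchronous resets such that $[\![\mathcal{T}]\!](\bar S)=[\![\phi]\!](\bar S)$ for every timed stream $\bar S$.
   Context: Events and streams. Events are partial finite-domain maps from attribute names to data values, each with a type in a set $\mathbf{T}$ of event types; predicates are sets of events from a fixed set $\mathbf{P}$ closed under intersection and complement and containing all events. A timed stream is $\bar S=(e_1,t_1)\cdots(e_n,t_n)$, $t_i\in\mathbb{Q}_{\ge0}$ strictly increasing. Fix a finite variable set $\mathbf{X}\supseteq\mathbf{T}$. A complex event is $C=(i,j,\mu)$, $1\le i\le j\le n$, $\mu:\mathbf{X}\to2^{\{i,\dots,j\}}$; $\mathrm{start}(C)=i$, $\mathrm{end}(C)=j$, $C(X)=\mu(X)$; $C_1\cup C_2$ takes min start, max end, pointwise union; $\pi_L(C)$ keeps start/end and $C(X)$ for $X\in L$, empty otherwise. Timed CEL syntax: $\varphi::=R\mid\varphi\ \mathrm{AS}\ X\mid\varphi\ \mathrm{FILTER}\ X[P]\mid\varphi\ \mathrm{OR}\ \varphi\mid\varphi\ \mathrm{AND}\ \varphi\mid\varphi;\varphi\mid\varphi:\varphi\mid\varphi+\mid\varphi\oplus\mid\pi_L(\varphi)\mid\langle\varphi\rangle_I\mid\varphi;_I\varphi\mid\varphi:_I\varphi\mid\varphi+_I\mid\varphi\oplus_I$, $I$ an interval of $\mathbb{Q}_{\ge0}$. The last five are the time operators; the others are CEL operators. Semantics: $[\![R]\!]=\{(i,i,\mu):\mathrm{type}(e_i)=R,\mu(R)=\{i\},\mu(X)=\emptyset\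 (X\ne R)\}$; $\mathrm{AS}\ X$: all $C$ with same start/end as some $C'\in[\![\varphi]\!]$, $C(X)=\bigcup_YC'(Y)$, other variables unchanged; FILTER keeps $C$ with every event indexed by $C(X)$ in $P$; OR/AND = union/intersection; $\varphi_1;\varphi_2$: $C_1\cup C_2$ with $C_k\in[\![\varphi_k]\!]$, $\mathrm{end}(C_1)<\mathrm{start}(C_2)$; $\varphi_1:\varphi_2$: same with $\mathrm{end}(C_1)+1=\mathrm{start}(C_2)$; $\varphi+=\varphi\cup(\varphi;\varphi+)$, $\varphi\oplus=\varphi\cup(\varphi:\varphi\oplus)$; $\pi_L$ projects each output; $\langle\varphi\rangle_I$ keeps $C$ with $t_{\mathrm{end}(C)}-t_{\mathrm{start}(C)}\in I$; $;_I$, $:_I$ are $;$, $:$ additionally requiring $t_{\mathrm{start}(C_2)}-t_{\mathrm{end}(C_1)}\in I$; $\varphi+_I=\varphi\cup(\varphi;_I(\varphi+_I))$, $\varphi\oplus_I=\varphi\cup(\varphi:_I(\varphi\oplus_I))$. A timed CEL formula is simple if it contains no projection $\pi_L$ and no time window $\langle\cdot\rangle_I$ as a subformula. A timed CEL formula is windowed if generated by $\phi::=\varphi\mid\psi\mid\phi\ \mathrm{AS}\ X\mid\phi\ \mathrm{FILTER}\ X[P]\mid\phi\ \mathrm{OR}\ \phi\mid\phi\ \mathrm{AND}\ \phi\mid\langle\phi\rangle_I$ where $\varphi$ is a formula with no time operators and $\psi$ is a simple timed CEL formula. Timed CEA. Clock conditions over a finite clock set $\mathbf{Z}$: $\gamma::=\mathrm{true}\mid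 z\sim c\ (\sim\in\{=,<,\le,\ge,>\},c\in\mathbb{Q}_{\ge0})\mid\gamma\wedge\gamma\mid\gamma\vee\gamma$. Clock valuations are partial maps $\nu:\mathbf{Z}\to\mathbb{R}_{\ge0}$; $\nu\models\gamma$ iff all clocks of $\gamma$ are defined and $\gamma$ holds; $\nu+t$ shifts defined clocks; $\mathrm{reset}_Z(\nu)$ sets clocks of $Z$ to $0$. A timed CEA is $(Q,\mathbf{P},\mathbf{X},\mathbf{Z},\Delta,q_0,F)$ with $\Delta\subseteq Q\times\mathbf{P}\times\mathcal{C}_{\mathbf{Z}}\times2^{\mathbf{X}}\times2^{\mathbf{Z}}\times Q$ finite; it has two clocks if $|\mathbf{Z}|=2$. With $\delta t_k=t_k-t_{k-1}$, $\delta t_1=t_1$, a run from $i$ to $j$ starts at $(q_0,\nu_i)$ with $\nu_i$ everywhere undefined and for each $k\in[i..j]$ uses $(p_k,P_k,\gamma_k,L_k,Z_k,p_{k+1})\in\Delta$ with $e_k\in P_k$, $\nu_k+\delta t_k\models\gamma_k$, $\nu_{k+1}=\mathrm{reset}_{Z_k}(\nu_k+\delta t_k)$; accepting if $p_{j+1}\in F$, outputting $(i,j,\mu)$ with $\mu(X)=\{k:X\in L_k\}$; $[\![\mathcal{T}]\!](\bar S)$ is the set of such outputs. $\mathcal{T}$ has synchronous resets if for every timed stream and every two runs (accepting or not) from the same $i$ to the same $j$ with the same label sequence $L_i,\dots,L_j$, the reset sets coincide: $Z_k=Z'_k$ for all $k$.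
   Formalization: The predicate set P is additionally assumed to contain, for each event type R, the predicate {e : type(e) = R}; without it the claim fails, e.g. for the atomic formula R when P consists only of the empty set and the set of all events. *)

(* Defs.v *)
From Stdlib Require List.
From HB Require Import structures.
From mathcomp Require Import all_boot all_order all_algebra.
Set Implicit Arguments. Unset Strict Implicit. Unset Printing Implicit Defensive.
Import Order.TTheory GRing.Theory Num.Theory.
Local Open Scope ring_scope.

(* The fixed set P of predicates: a type of predicate names with their
   denotation (a set of events), closed under intersection and complement,
   containing the set of all events and the type predicates type(e) = R. *)
Record predsys (Ev Ty : Type) (etype : Ev -> Ty) := PredSys {
  pr : Type;
  den : pr -> Ev -> Prop;
  ptrue : pr;
  pand : pr -> pr -> pr;
  pcompl : pr -> pr;
  ptype : Ty -> pr;
  ptrueE : forall e, den ptrue e;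
  pandE : forall p q e, den (pand p q) e <-> den p e /\ den q e;
  pcomplE : forall p e, den (pcompl p) e <-> ~ den p e;
  ptypeE : forall R e, den (ptype R) e <-> etype e = R }.

Section CEL.
Variables (Ev Ty : Type) (Var : finType) (tv : Ty -> Var) (etype : Ev -> Ty)
          (PS : predsys etype).
Local Notation Pr := (pr PS).

Inductive tform :=
| FAtom of Ty
| FAs of tform & Var
| FFilter of tform & Var & Pr
| FOr of tform & tform
| FAnd of tform & tform
| FSeq of tform & tform
| FNext of tform & tform
| FPlus of tform
| FOplus of tform
| FProj of {set Var} & tform
| FWin of tform & interval rat
| FSeqI of interval rat & tform & tform
| FNextI of interval rat & tform & tform
| FPlusI of interval rat & tform
| FOplusI of interval rat & tform.

Fixpoint no_time (f : tform) : bool :=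
  match f with
  | FAtom _ => true
  | FAs g _ | FFilter g _ _ | FPlus g | FOplus g | FProj _ g => no_time g
  | FOr g h | FAnd g h | FSeq g h | FNext g h => no_time g && no_time h
  | _ => false
  end.

Fixpoint simple (f : tform) : bool :=
  match f with
  | FAtom _ => true
  | FAs g _ | FFilter g _ _ | FPlus g | FOplus g | FPlusI _ g | FOplusI _ g =>
      simple g
  | FOr g h | FAnd g h | FSeq g h | FNext g h | FSeqI _ g h | FNextI _ g h =>
      simple g && simple h
  | FProj _ _ | FWin _ _ => false
  end.

Fixpoint windowed (f : tform) : bool :=
  [|| no_time f, simple f |
   match f with
   | FAs g _ | FFilter g _ _ | FWin g _ => windowed g
   | FOr g h | FAnd g h => windowed g && windowed h
   | _ => false
   end].

(* position k (1-based) of S holds the pair (e_k, t_k) = nth (k-1) S *)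
Definition stream := seq (Ev * rat).

Definition valid_stream (S : stream) : bool :=
  all (fun et => 0 <= et.2) S && sorted <%R (map snd S).

(* t_k for 1 <= k <= |S|, and t_0 := 0 (so that delta t_1 = t_1) *)
Definition tm (S : stream) (k : nat) : rat :=
  if k is k'.+1 then odflt 0 (omap snd (onth S k')) else 0.

Definition evsat (S : stream) (k : nat) (p : Pr) : Prop :=
  (0 < k)%N /\ exists e, omap fst (onth S k.-1) = Some e /\ den p e.

Record ce := CE { cstart : nat; cend : nat; cmu : Var -> nat -> bool }.

Definition ce_union (C1 C2 : ce) : ce :=
  CE (minn (cstart C1) (cstart C2)) (maxn (cend C1) (cend C2))
     (fun X k => cmu C1 X k || cmu C2 X k).

Definition seqcomb (cond : nat -> nat -> Prop) (P Q : ce -> Prop) (C : ce) : Prop :=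
  exists C1 C2, [/\ P C1, Q C2, cond (cend C1) (cstart C2) & C = ce_union C1 C2].

(* itercomb cond P m = P o (P o (... o P)) with m+1 copies of P *)
Fixpoint itercomb (cond : nat -> nat -> Prop) (P : ce -> Prop) (m : nat) : ce -> Prop :=
  if m is m'.+1 then seqcomb cond P (itercomb cond P m') else P.

(* least solution of X = P \/ (P o X) *)
Definition pluscomb cond P (C : ce) : Prop := exists m, itercomb cond P m C.

Section Sem.
Variable S : stream.

Definition c_seq (a b : nat) : Prop := (a < b)%N.
Definition c_next (a b : nat) : Prop := a.+1 = b.
Definition c_seqI (I : interval rat) (a b : nat) : Prop :=
  (a < b)%N /\ tm S b - tm S a \in I.
Definition c_nextI (I : interval rat) (a b : nat) : Prop :=
  a.+1 = b /\ tm S b - tm S a \in I.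

Fixpoint sem (f : tform) : ce -> Prop :=
  match f with
  | FAtom R => fun C => exists i, (0 < i)%N /\
      (exists e, omap fst (onth S i.-1) = Some e /\ etype e = R) /\
      C = CE i i (fun X k => (X == tv R) && (k == i))
  | FAs g X => fun C => exists C', sem g C' /\
      C = CE (cstart C') (cend C')
             (fun Y k => if Y == X then [exists Y', cmu C' Y' k] else cmu C' Y k)
  | FFilter g X p => fun C => sem g C /\ forall k, cmu C X k -> evsat S k p
  | FOr g h => fun C => sem g C \/ sem h C
  | FAnd g h => fun C => sem g C /\ sem h C
  | FSeq g h => seqcomb c_seq (sem g) (sem h)
  | FNext g h => seqcomb c_next (sem g) (sem h)
  | FPlus g => pluscomb c_seq (sem g)
  | FOplus g => pluscomb c_next (sem g)
  | FProj L g => fun C => exists C', sem g C' /\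
      C = CE (cstart C') (cend C') (fun X k => (X \in L) && cmu C' X k)
  | FWin g J => fun C => sem g C /\ tm S (cend C) - tm S (cstart C) \in J
  | FSeqI J g h => seqcomb (c_seqI J) (sem g) (sem h)
  | FNextI J g h => seqcomb (c_nextI J) (sem g) (sem h)
  | FPlusI J g => pluscomb (c_seqI J) (sem g)
  | FOplusI J g => pluscomb (c_nextI J) (sem g)
  end.

End Sem.

Definition clock := 'I_2.

Inductive cmp := CEq | CLt | CLe | CGe | CGt.

Inductive ccond :=
| CTrue
| CAtom of clock & cmp & rat
| CAnd of ccond & ccond
| COr of ccond & ccond.

Fixpoint ccond_wf (g : ccond) : bool :=
  match g with
  | CTrue => true
  | CAtom _ _ c => 0 <= c
  | CAnd g h | COr g h => ccond_wf g && ccond_wf h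
  end.

Fixpoint cclocks (g : ccond) : seq clock :=
  match g with
  | CTrue => [::]
  | CAtom z _ _ => [:: z]
  | CAnd g h | COr g h => cclocks g ++ cclocks h
  end.

Definition cmpR (o : cmp) (x c : rat) : bool :=
  match o with
  | CEq => x == c | CLt => x < c | CLe => x <= c | CGe => c <= x | CGt => c < x
  end.

Definition cval := clock -> option rat.

Fixpoint cholds (nu : cval) (g : ccond) : bool :=
  match g with
  | CTrue => true
  | CAtom z o c => if nu z is Some v then cmpR o v c else false
  | CAnd g h => cholds nu g && cholds nu h
  | COr g h => cholds nu g || cholds nu h
  end.

Definition csat (nu : cval) (g : ccond) : bool :=
  all (fun z => nu z != None) (cclocks g) && cholds nu g.

Definition vshift (nu : cval) (t : rat) : cval := fun z => omap (fun v => v + t) (nu z).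
Definition vreset (Z : {set clock}) (nu : cval) : cval :=
  fun z => if z \in Z then Some 0 else nu z.
Definition vundef : cval := fun _ => None.

Record trans := Trans {
  tsrc : nat; tpred : Pr; tguard : ccond;
  tlab : {set Var}; treset : {set clock}; tdst : nat }.

Record tcea := TCEA { tdelta : seq trans; tinit : nat; tfinal : seq nat }.

Definition tcea_wf (A : tcea) : Prop :=
  forall d, List.In d (tdelta A) -> ccond_wf (tguard d).

Fixpoint run (A : tcea) (S : stream) (k : nat) (p : nat) (nu : cval)
    (rs : seq trans) : Prop :=
  match rs with
  | [::] => True
  | d :: rs' =>
      let nu' := vshift nu (tm S k - tm S k.-1) in
      [/\ List.In d (tdelta A), tsrc d = p, evsat S k (tpred d),
          csat nu' (tguard d) &
          run A S k.+1 (tdst d) (vreset (treset d) nu') rs']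
  end.

Definition tcea_out (A : tcea) (S : stream) (C : ce) : Prop :=
  exists i j rs, [/\ (0 < i <= j)%N, size rs = (j - i).+1,
    run A S i (tinit A) vundef rs,
    last (tinit A) (map tdst rs) \in tfinal A &
    C = CE i j (fun X k =>
          has (fun kd => (kd.1 == k) && (X \in tlab kd.2)) (zip (iota i (size rs)) rs))].

Definition sync_resets (A : tcea) : Prop :=
  forall S, valid_stream S -> forall i rs rs', (0 < i)%N ->
    run A S i (tinit A) vundef rs -> run A S i (tinit A) vundef rs' ->
    size rs = size rs' -> map tlab rs = map tlab rs' ->
    map treset rs = map treset rs'.

End CEL.

(* Main.v *)
(* Clock 0 is reset by the first transition of a run and clock 1 by every
   transition with a nonempty label, so resets depend only on the labels. In a
   simple formula every factor of a sequencing or iteration ends at a marked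
   position; when the next factor starts, clock 1 therefore shows exactly the gap
   to be tested. AS preserves the set of marked positions, AND and OR combine
   automata reading the same labels, and a window is a test of clock 0 on the last
   letter. Projection may erase marks, but occurs only below formulas without
   time operators, where no clock is tested.
   Hence it suffices to close regular languages of words over letters (event,
   clock values, label) under the operations of the logic. *)
Require Import Defs.
From Stdlib Require List.
From Stdlib Require Import FunctionalExtensionality.
From mathcomp Require Import all_boot all_order all_algebra.
From mathcomp Require Import zify.
Set Implicit Arguments. Unset Strict Implicit. Unset Printing Implicit Defensive.
Import Order.TTheory GRing.Theory Num.Theory.

(** * Regular languages of clocked words *)

Section Automata.
Variables (Ev Ty : Type) (Var : finType) (etype : Ev -> Ty) (PS : predsys etype).

(** The obstacle is that the clock values of a run depend on its start and on its labels, whereas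
    closure constructions want a free alphabet. Hence clock values are part of the letters, and
    languages range over all words, even those that no run produces. Only [regular] ties a language
    to streams, under the hypothesis [compat] that the word carries correct clock values; its two
    flags say for which clocks this is assumed. This hypothesis has to survive every operation.
    Passing to a factor moves the start, so sequencing and iteration are treated without any
    assumption on clock 0. Erasing marks changes the times at which clock 1 is reset, so projection
    is treated without any assumption on clock 1. The two kinds of base formulas meet once both
    flags are weakened to [true]. Compatible words do exist: resets depend only on the labels, so
    the start and the labels of a run determine all its clock values. *)

Record letter := Letter { lev : Ev; lclk : cval; llab : {set Var} }.

Definition relabel (x : letter) (l : {set Var}) := Letter (lev x) (lclk x) l.

Definition atom : Type := (pr PS * ccond * {set Var})%type.

Definition asat (x : letter) (a : atom) : Prop :=
  [/\ den a.1.1 (lev x), csat (lclk x) a.1.2 & llab x = a.2].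

(** An atom holds exactly the data of one transition (predicate, guard, label), so a definable step
    relation compiles to finitely many transitions. *)
Definition definable (R : letter -> Prop) : Prop :=
  exists al : seq atom, (forall a, List.In a al -> ccond_wf a.1.2) /\
    forall x, R x <-> exists a, List.In a al /\ asat x a.

Lemma definable_ext (R R' : letter -> Prop) :
  (forall x, R x <-> R' x) -> definable R -> definable R'.
Proof.
move=> E [al [wf H]]; exists al; split=> // x.
by rewrite -E.
Qed.

Lemma definable_False : definable (fun=> False).
Proof. by exists [::]; split=> // x; split=> // -[a []]. Qed.

Lemma definable_asat (a : atom) : ccond_wf a.1.2 -> definable (asat^~ a).
Proof.
move=> wf; exists [:: a]; split=> [b [<-|[]] //|x].
by split=> [h|[b [[<-|[]] //]]]; exists a; split=> //; left.
Qed.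

Lemma definable_or (R R' : letter -> Prop) :
  definable R -> definable R' -> definable (fun x => R x \/ R' x).
Proof.
move=> [al [wf H]] [al' [wf' H']]; exists (al ++ al')%SEQ; split.
  by move=> a ia; case: (List.in_app_or _ _ _ ia) => [/wf|/wf'].
move=> x; rewrite H H'; split.
  by case=> -[a [ia sa]]; exists a; split=> //; apply/List.in_or_app; [left|right].
by case=> a [ia sa]; case: (List.in_app_or _ _ _ ia) => ib; [left|right]; exists a.
Qed.

Lemma definable_exIn (T : Type) (s : seq T) (R : T -> letter -> Prop) :
  (forall t, List.In t s -> definable (R t)) ->
  definable (fun x => exists t, List.In t s /\ R t x).
Proof.
elim: s => [|t s IH] H.
  by apply: definable_ext definable_False => x; split=> // -[? []].
have D := definable_or (H t (or_introl erefl)) (IH (fun u iu => H u (or_intror iu))).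
apply: definable_ext D => x; split.
  by case=> [h|[u [iu h]]]; [exists t; split=> //; left|exists u; split=> //; right].
by case=> u [[<-|iu] h]; [left|right; exists u].
Qed.

Lemma In_enum (T : finType) (t : T) : List.In t (enum T).
Proof.
have: t \in enum T by rewrite mem_enum.
elim: (enum T) => [//|u s IH]; rewrite inE => /orP[/eqP->|/IH]; by [left|right].
Qed.

Lemma definable_ex (T : finType) (R : T -> letter -> Prop) :
  (forall t, definable (R t)) -> definable (fun x => exists t, R t x).
Proof.
move=> H; apply: definable_ext (definable_exIn (s := enum T) (fun t _ => H t)) => x.
by split=> [[t [_ h]]|[t h]]; exists t => //; split=> //; apply: In_enum.
Qed.

Lemma csat_and nu g h : csat nu (CAnd g h) = csat nu g && csat nu h.
Proof. by rewrite /csat /= all_cat andbACA. Qed.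

Lemma definable_and (R R' : letter -> Prop) :
  definable R -> definable R' -> definable (fun x => R x /\ R' x).
Proof.
move=> [al [wf H]] [al' [wf' H']].
have D : definable (fun x => exists a, List.In a al /\
    exists b, List.In b al' /\ (asat x a /\ asat x b)).
  apply: definable_exIn => a ia; apply: definable_exIn => b ib.
  (* An atom fixes the whole label, so two atoms with different labels are incompatible. *)
  have [eab|nab] := eqVneq a.2 b.2; last first.
    apply: definable_ext definable_False => x; split=> // -[[_ _ e] [_ _ e']].
    by move: nab; rewrite -e -e' eqxx.
  have w : ccond_wf (CAnd a.1.2 b.1.2) by rewrite /= (wf _ ia) (wf' _ ib).
  apply: definable_ext (definable_asat (a := (pand a.1.1 b.1.1, CAnd a.1.2 b.1.2, a.2)) w).
  move=> x; rewrite /asat /= csat_and; split.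
    by case=> /pandE [? ?] /andP[? ?] e; rewrite -eab.
  by case=> -[h1 h2 h3] [h4 h5 _]; split=> //; [apply/pandE|rewrite h2].
apply: definable_ext D => x; rewrite H H'; split.
  by case=> a [ia [b [ib [sa sb]]]]; split; [exists a|exists b].
by case=> -[a [ia sa]] [b [ib sb]]; exists a; split=> //; exists b.
Qed.

(** Leaving the label free costs one atom for each of the finitely many labels. *)
Lemma definable_sat (p : pr PS) (g : ccond) : ccond_wf g ->
  definable (fun x => den p (lev x) /\ csat (lclk x) g).
Proof.
move=> wf; have D l := @definable_asat (p, g, l) wf.
apply: definable_ext (definable_ex D) => x; split; first by case=> l [].
by case=> h1 h2; exists (llab x).
Qed.

Lemma definable_den (p : pr PS) : definable (fun x => den p (lev x)).
Proof.
by apply: definable_ext (definable_sat p (g := CTrue) isT) => x; split=> [[]|].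
Qed.

Lemma definable_csat (g : ccond) : ccond_wf g ->
  definable (fun x => csat (lclk x) g).
Proof.
move=> wf; apply: definable_ext (definable_sat (ptrue PS) wf) => x.
by split=> [[]|] //; split=> //; apply: ptrueE.
Qed.

Lemma definable_True : definable (fun=> True).
Proof. by apply: definable_ext (definable_csat (g := CTrue) isT). Qed.

Lemma definable_bool (b : bool) : definable (fun=> b).
Proof.
case: b; first by apply: definable_ext definable_True.
by apply: definable_ext definable_False.
Qed.

Lemma definable_lab (P : pred {set Var}) : definable (fun x => P (llab x)).
Proof.
have D l : definable (fun x => P l /\ llab x = l).
  apply: definable_and (definable_bool _) _.
  apply: definable_ext (definable_asat (a := (ptrue PS, CTrue, l)) isT) => x.
  by split=> [[]|h] //; split=> //; apply: ptrueE.
apply: definable_ext (definable_ex D) => x.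
by split=> [[l [h ->]]|h] //; exists (llab x).
Qed.

Lemma definable_relabel (R : letter -> Prop) (l : {set Var}) :
  definable R -> definable (fun x => R (relabel x l)).
Proof.
move=> [al [wf H]].
have D : definable (fun x => exists a, List.In a al /\
    ((l == a.2) /\ (den a.1.1 (lev x) /\ csat (lclk x) a.1.2))).
  apply: definable_exIn => a ia.
  apply: definable_and (definable_bool _) (definable_sat _ _).
  exact: wf.
apply: definable_ext D => x; rewrite H; split.
  by case=> a [ia [/eqP e [h1 h2]]]; exists a.
by case=> a [ia [h1 h2 /= e]]; exists a; split=> //; split=> //; apply/eqP.
Qed.

(** Guards mention only nonnegative constants, but [J] may have negative endpoints. The conjunct
    [0 <= v] reconciles the two, and costs nothing since the elapsed times tested later are
    nonnegative. *)
Definition clkin (z : clock) (J : interval rat) (x : letter) : Prop :=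
  exists v, [/\ lclk x z = Some v, (0 <= v)%R & v \in J].

Lemma definable_cmp z o c : definable (fun x =>
  exists v, [/\ lclk x z = Some v, (0 <= v)%R & cmpR o v c]).
Proof.
have [c0|c0] := leP 0%R c.
  apply: definable_ext (definable_csat (g := CAnd (CAtom z CGe 0) (CAtom z o c)) _).
    move=> x; rewrite csat_and /csat /=; case: (lclk x z) => [v|] /=.
      rewrite ?andbT; split=> [/andP[h1 h2]|[w [[<-] -> ->]]] //.
      by exists v.
    by split=> // -[? []].
  exact: c0.
have pos v : (0 <= v)%R -> (c < v)%R by apply: lt_le_trans.
(* For negative [c], every nonnegative value compares with [c] as [0] does, so the test is
   constant. *)
have [up|dn] := boolP (cmpR o 0 c).
  have E v : (0 <= v)%R -> cmpR o v c.
    move=> /pos h; move: up; case: {+}o => //=; rewrite ?(ltW h) //.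
    - by move=> /eqP e; rewrite -e ltxx in c0.
    - by move=> h'; have := lt_trans h' c0; rewrite ltxx.
    - by move=> h'; have := le_lt_trans h' c0; rewrite ltxx.
  apply: definable_ext (definable_csat (g := CAtom z CGe 0) _) => [x|//].
  rewrite /csat /=; case: (lclk x z) => [v|] /=; last by split=> // -[? []].
  rewrite ?andbT; split=> [h|[w [[<-] h _]]] //.
  by exists v; split=> //; apply: E.
apply: definable_ext definable_False => x; split=> // -[v [_ /pos h]].
move: dn; case: {+}o => //=; rewrite ?(ltW c0) ?c0 // => _.
- by move=> /eqP e; rewrite e ltxx in h.
- by move=> h'; have := lt_trans h' h; rewrite ltxx.
- by move=> h'; have := le_lt_trans h' h; rewrite ltxx.
Qed.

Lemma definable_clkin z J : definable (clkin z J).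
Proof.
(* [T] and [F] serve the infinite bounds, where the comparison reduces to a constant. *)
have T : definable (fun x => exists v, [/\ lclk x z = Some v, (0 <= v)%R & true]).
  apply: definable_ext (definable_cmp z CGe 0) => x.
  by split=> -[v [h1 h2 _]]; exists v.
have F : definable (fun x => exists v, [/\ lclk x z = Some v, (0 <= v)%R & false]).
  by apply: definable_ext definable_False => x; split=> // -[v []].
case: J => a b.
have Da : definable (fun x => exists v,
    [/\ lclk x z = Some v, (0 <= v)%R & (a <= BLeft v)%O]).
  case: a => [[] c|[]] //.
  - by apply: definable_ext (definable_cmp z CGe c) => x;
      split=> -[v [h1 h2 h3]]; exists v.
  - by apply: definable_ext (definable_cmp z CGt c) => x;
      split=> -[v [h1 h2 h3]]; exists v.
have Db : definable (fun x => exists v,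
    [/\ lclk x z = Some v, (0 <= v)%R & (BRight v <= b)%O]).
  case: b => [[] c|[]] //.
  - by apply: definable_ext (definable_cmp z CLt c) => x;
      split=> -[v [h1 h2 h3]]; exists v.
  - by apply: definable_ext (definable_cmp z CLe c) => x;
      split=> -[v [h1 h2 h3]]; exists v.
apply: definable_ext (definable_and Da Db) => x; split.
  case=> -[v [h1 h2 h3]] [w [h4 _ h5]]; exists v; split=> //.
  rewrite itv_boundlr h3 /=; move: h1; rewrite h4 => -[<-] //.
case=> v [h1 h2]; rewrite itv_boundlr => /andP[h3 h4].
by split; exists v.
Qed.

(** * Automata with definable steps and their closure properties *)

Record nfa := NFA {
  st : finType; ini : pred st; fin : pred st;
  stp : st -> letter -> st -> Prop;
  stpD : forall q q', definable (fun x => stp q x q') }.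

(** A word is read on an interval of positions of a fixed function, so its factors keep their
    positions and nothing is re-indexed. All words considered are nonempty. *)
Definition lang := (nat -> letter) -> nat -> nat -> Prop.

Definition acc (N : nfa) : lang := fun x i j =>
  exists s : nat -> st N, [/\ ini (s i), fin (s j.+1) &
    forall k, i <= k <= j -> stp (s k) (x k) (s k.+1)].

Definition recog (L : lang) : Prop :=
  exists N, forall x i j, i <= j -> L x i j <-> acc N x i j.

Lemma recog_ext (L L' : lang) :
  (forall x i j, i <= j -> L x i j <-> L' x i j) -> recog L -> recog L'.
Proof.
by move=> E [N H]; exists N => x i j ij; rewrite -E // H.
Qed.

Lemma path_inv (P : nat -> Prop) i j : P i ->
  (forall k, i <= k <= j -> P k -> P k.+1) -> forall k, i <= k <= j.+1 -> P k.
Proof.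
move=> P0 PS'; elim=> [|k IH] h; first by have <- : i = 0 by lia.
have [e|ne] := eqVneq i k.+1; first by rewrite -e.
by apply: PS'; [lia|apply: IH; lia].
Qed.

Lemma recog_all (R : letter -> Prop) : definable R ->
  recog (fun x i j => forall k, i <= k <= j -> R (x k)).
Proof.
move=> D.
exists (@NFA unit xpredT xpredT (fun _ x _ => R x) (fun _ _ => D)) => x i j ij.
by split=> [h|[s [_ _ h]] //]; exists (fun=> tt).
Qed.

Lemma recog_letter (R : letter -> Prop) : definable R ->
  recog (fun x i j => i = j /\ R (x i)).
Proof.
move=> D.
have D' (q q' : bool) : definable (fun x => (~~ q && q') /\ R x).
  exact: definable_and (definable_bool _) D.
exists (@NFA bool negb id _ D') => x i j ij; split.
  case=> <- h; exists (fun k => i < k); split=> [/=|/=|k kij]; [lia|lia|].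
  have -> : k = i by lia.
  by rewrite /= ltnn ltnSn.
case=> s [/= s0 s1 h].
have [/andP[_ si] Ri] := h i ltac:(lia).
have [//|ne] := eqVneq i j.
by have [/andP[]] := h i.+1 ltac:(lia); rewrite si.
Qed.

Lemma recog_and (L1 L2 : lang) :
  recog L1 -> recog L2 -> recog (fun x i j => L1 x i j /\ L2 x i j).
Proof.
move=> [N1 H1] [N2 H2].
have D (q q' : st N1 * st N2) :
    definable (fun x => stp q.1 x q'.1 /\ stp q.2 x q'.2).
  by apply: definable_and; apply: stpD.
exists (@NFA (st N1 * st N2)%type (fun q => ini q.1 && ini q.2)
   (fun q => fin q.1 && fin q.2) _ D) => x i j ij; rewrite H1 // H2 //; split.
  case=> -[s [a b c]] [s' [a' b' c']]; exists (fun k => (s k, s' k)).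
  by split=> /= [||k hk]; [rewrite a a'|rewrite b b'|split; [apply: c|apply: c']].
case=> s [/= /andP[a a'] /andP[b b'] c].
by split; [exists (fun k => (s k).1)|exists (fun k => (s k).2)]; split=> // k /c [].
Qed.

Lemma recog_or (L1 L2 : lang) :
  recog L1 -> recog L2 -> recog (fun x i j => L1 x i j \/ L2 x i j).
Proof.
move=> [N1 H1] [N2 H2].
pose step (q : st N1 + st N2) x (q' : st N1 + st N2) : Prop :=
  match q, q' with
  | inl p, inl p' => stp p x p'
  | inr p, inr p' => stp p x p'
  | _, _ => False
  end.
have D q q' : definable (fun x => step q x q').
  by case: q q' => p [p'|p']; try exact: stpD; exact: definable_False.
exists (@NFA (st N1 + st N2)%type
   (fun q => match q with inl p => ini p | inr p => ini p end)
   (fun q => match q with inl p => fin p | inr p => fin p end) _ D) => x i j ij.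
rewrite H1 // H2 //; split.
  by case=> -[s [a b c]]; [exists (fun k => inl (s k))|exists (fun k => inr (s k))].
case=> s [/=]; case si: (s i) => [p|p] a b c; [left|right].
  (* No step leaves its summand, so the initial state decides for the whole run. *)
  have I : forall k, i <= k <= j.+1 -> exists p', s k = inl p'.
    apply: path_inv => [|k hk [p' e]]; first by exists p.
    by move: (c k hk); rewrite e; case: (s k.+1) => // p'' _; exists p''.
  pose f k := if s k is inl p' then p' else p.
  exists f; split; rewrite /f.
  - by rewrite si.
  - by have [p' e] := I j.+1 ltac:(lia); rewrite e in b *.
  - move=> k hk; have [p1 e1] := I k ltac:(lia); have [p2 e2] := I k.+1 ltac:(lia).
    by move: (c k hk); rewrite e1 e2.
have I : forall k, i <= k <= j.+1 -> exists p', s k = inr p'.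
  apply: path_inv => [|k hk [p' e]]; first by exists p.
  by move: (c k hk); rewrite e; case: (s k.+1) => // p'' _; exists p''.
pose f k := if s k is inr p' then p' else p.
exists f; split; rewrite /f.
- by rewrite si.
- by have [p' e] := I j.+1 ltac:(lia); rewrite e in b *.
- move=> k hk; have [p1 e1] := I k ltac:(lia); have [p2 e2] := I k.+1 ltac:(lia).
  by move: (c k hk); rewrite e1 e2.
Qed.

Definition conc (L1 L2 : lang) : lang := fun x i j =>
  exists a, [/\ i <= a < j, L1 x i a & L2 x a.+1 j].

(** Replaces an epsilon transition: a letter that could complete a factor by reaching a final state
    may lead directly to an initial state of the next factor instead. *)
Definition last_stp (N : nfa) (q : st N) (x : letter) : Prop :=
  exists qf, fin qf /\ stp q x qf.

Lemma last_stpD (N : nfa) (q : st N) : definable (last_stp q).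
Proof.
by apply: definable_ex => qf; apply: definable_and (definable_bool _) (stpD _ _).
Qed.

Lemma recog_conc (L1 L2 : lang) : recog L1 -> recog L2 -> recog (conc L1 L2).
Proof.
move=> [N1 H1] [N2 H2].
(* The boolean marks the states entered by the jump: the second factor is nonempty. *)
pose T := (st N1 + st N2 * bool)%type.
pose step (q : T) x (q' : T) : Prop :=
  match q, q' with
  | inl p, inl p' => stp p x p'
  | inl p, inr (p', b) => (b && ini p') /\ last_stp p x
  | inr (p, _), inr (p', b) => ~~ b /\ stp p x p'
  | _, _ => False
  end.
have D q q' : definable (fun x => step q x q').
  case: q q' => [p|[p ?]] [p'|[p' b]]; try exact: stpD; try exact: definable_False.
    exact: definable_and (definable_bool _) (last_stpD _).
  exact: definable_and (definable_bool _) (stpD _ _).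
exists (@NFA T (fun q => if q is inl p then ini p else false)
   (fun q => if q is inr (p, b) then ~~ b && fin p else false) _ D) => x i j ij; split.
  case=> a [haj /H1 h1 /H2 h2].
  have [s1 [a1 b1 c1]] := h1 ltac:(lia); have [s2 [a2 b2 c2]] := h2 ltac:(lia).
  exists (fun k => if k <= a then inl (s1 k) else inr (s2 k, k == a.+1)); split=> /=.
  - by have -> : i <= a by lia.
  - have -> : (j < a) = false by lia.
    by have -> : (j.+1 == a.+1) = false by lia.
  - move=> k hk; case: (ltngtP k a) => ka.
    + by apply: c1; lia.
    + by split; [lia|apply: c2; lia].
    + rewrite /= ka eqxx; split=> //; exists (s1 a.+1); split=> //.
      by apply: c1; lia.
case=> s [/= si sf c].
(* The least such [k] is the state entered by the jump; the letter before it ends the first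
   factor. *)
pose R k := (i < k) && (if s k is inr _ then true else false).
have Rj : R j.+1 by rewrite /R ltnS ij /=; case: (s j.+1) sf.
case: (ex_minnP (ex_intro R _ Rj)) => m /andP[im sm] mmin.
have mj := mmin _ Rj.
have L k : i <= k < m -> exists p, s k = inl p.
  move=> hk; case e: (s k) => [p|p]; first by exists p.
  have [e'|ne] := eqVneq i k; first by rewrite e' e in si.
  have: R k by rewrite /R e; lia.
  by move=> /mmin; lia.
have Rr : forall k, m <= k <= j.+1 -> exists p, s k = inr p.
  apply: path_inv => [|k hk [[p b] e]]; first by case: (s m) sm => // p _; exists p.
  by move: (c k ltac:(lia)); rewrite e; case: (s k.+1) => // p' _; exists p'.
case: m im sm mmin mj L Rr => [//|a] im sm mmin mj L Rr.
have [pa ea] := L a ltac:(lia); have [[pb b] eb] := Rr a.+1 ltac:(lia).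
have := c a ltac:(lia); rewrite ea eb => -[/andP[tb ib] [qf [fqf sqf]]].
(* Final states carry the boolean [false], the state entered by the jump carries [true]: at least
   one more letter follows. *)
have haj : a < j.
  rewrite ltn_neqAle -ltnS mj andbT; apply/eqP => e.
  by move: sf; rewrite -e eb tb.
exists a; split; first lia.
  apply/H1; first lia.
  (* At [a.+1] the run has already jumped; [qf] is the final state it could have reached. [pa] is
     only a default. *)
  exists (fun k => if k == a.+1 then qf else if s k is inl p then p else pa); split.
  - have -> : (i == a.+1) = false by lia.
    by case: (s i) si.
  - by rewrite eqxx.
  - move=> k hk; have -> : (k == a.+1) = false by lia.
    rewrite eqSS; have [->|ne] := eqVneq k a; first by rewrite ea.
    have [p e] := L k ltac:(lia); have [p' e'] := L k.+1 ltac:(lia).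
    by move: (c k ltac:(lia)); rewrite e e'.
apply/H2; first lia.
exists (fun k => if s k is inr p then p.1 else pb); split.
- by rewrite eb.
- by case: (s j.+1) sf => // -[p ?] /andP[].
- move=> k hk; have [[p ?] e] := Rr k ltac:(lia); have [[p' ?] e'] := Rr k.+1 ltac:(lia).
  by move: (c k ltac:(lia)); rewrite e e' => -[].
Qed.

Inductive iterL (L : lang) (x : nat -> letter) (j : nat) : nat -> Prop :=
| iterL_one i : i <= j -> L x i j -> iterL L x j i
| iterL_more i a : i <= a < j -> L x i a -> iterL L x j a.+1 -> iterL L x j i.

Lemma recog_iter (L : lang) : recog L -> recog (fun x i j => iterL L x j i).
Proof.
move=> [N H].
(* The boolean marks the states at which a new factor starts. *)
pose step (q : st N * bool) x (q' : st N * bool) : Prop :=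
  if q'.2 then ini q'.1 /\ last_stp q.1 x else stp q.1 x q'.1.
have D q q' : definable (fun x => step q x q').
  rewrite /step; case: q'.2; last exact: stpD.
  exact: definable_and (definable_bool _) (last_stpD _).
(* The boolean is free in an initial state, so the tail of a run from a flagged state is again
   accepting. It is [false] in a final state, so no empty factor is started at the end. *)
pose A := @NFA (st N * bool)%type (fun q => ini q.1) (fun q => ~~ q.2 && fin q.1) _ D.
exists A => x i j ij; split.
  move=> h; elim: h => {i ij} i.
    move=> ij /(H _ _ _ ij) [s [a b c]].
    by exists (fun k => (s k, false)); split.
  move=> a iaj /H h _ [s2 [/= a2 b2 c2]].
  have [s1 [a1 b1 c1]] := h ltac:(lia).
  exists (fun k => if k <= a then (s1 k, false) else if k == a.+1 then ((s2 k).1, true)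
     else s2 k); split=> /=.
  - by have -> : i <= a by lia.
  - have -> : (j < a) = false by lia.
    by have -> : (j.+1 == a.+1) = false by lia.
  - move=> k hk; rewrite eqSS; case: (ltngtP k a) => ka.
    + by apply: c1; lia.
    + have := c2 k ltac:(lia); rewrite /step.
      by case: eqVneq => [->|].
    + rewrite /step /= ka; split=> //; exists (s1 a.+1); split=> //.
      by apply: c1; lia.
(* Strong induction on the length, splitting off the factor that ends just before the first flagged
   state after [i]. *)
have [n] := ubnP (j - i); elim: n => // n IH in i ij * => hn [s [/= si /andP[sf sf'] c]].
pose R k := (i < k <= j.+1) && (s k).2.
have [/existsP[k0 Rk0]|none] := boolP [exists k : 'I_j.+2, R k]; last first.
  apply: iterL_one => //; apply/H => //; exists (fun k => (s k).1); split=> // k hk.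
  have := c k hk; rewrite /step; case e: (s k.+1).2 => //.
  case/existsP: none; exists (inord k.+1); rewrite /R inordK ?e; lia.
case: (ex_minnP (ex_intro R _ Rk0)) => [[//|a]] /andP[im sm] mmin.
have aj : a < j.
  rewrite ltn_neqAle -ltnS; apply/andP; split; last lia.
  by apply/eqP => e; rewrite -e sm in sf.
have := c a ltac:(lia); rewrite /step sm => -[ia [qf [fqf sqf]]].
apply: (@iterL_more _ _ _ _ a); first lia.
  apply/H; first lia.
  exists (fun k => if k == a.+1 then qf else (s k).1); split.
  - by have -> : (i == a.+1) = false by lia.
  - by rewrite eqxx.
  - move=> k hk; have -> : (k == a.+1) = false by lia.
    rewrite eqSS; have [->|ne] := eqVneq k a; first by [].
    have := c k ltac:(lia); rewrite /step; case e: (s k.+1).2 => //.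
    have: R k.+1 by rewrite /R e; lia.
    by move=> /mmin; lia.
apply: IH; [lia|lia|].
exists s; split=> //=; first by rewrite sf.
by move=> k hk; apply: c; lia.
Qed.

(** The state guesses the original label of the next letter; the step checks its image under [f]
    against the label actually read. *)
Lemma recog_relabel (f : {set Var} -> {set Var}) (L : lang) : recog L ->
  recog (fun x i j => exists l : nat -> {set Var},
    (forall k, i <= k <= j -> f (l k) = llab (x k)) /\
    L (fun k => relabel (x k) (l k)) i j).
Proof.
move=> [N H].
pose step (q : st N * {set Var}) x (q' : st N * {set Var}) : Prop :=
  f q.2 == llab x /\ stp q.1 (relabel x q.2) q'.1.
have D q q' : definable (fun x => step q x q').
  apply: definable_and; first exact: (definable_lab (fun l => f q.2 == l)).
  exact: (definable_relabel _ (stpD _ _)).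
exists (@NFA (st N * {set Var})%type (fun q => ini q.1) (fun q => fin q.1) _ D).
move=> x i j ij; split.
  case=> l [fl /H h]; have [s [a b c]] := h ij.
  exists (fun k => (s k, l k)); split=> // k hk; split; last exact: c.
  by apply/eqP/fl.
case=> s [/= a b c]; exists (fun k => (s k).2); split.
  by move=> k /c [/eqP].
by apply/H => //; exists (fun k => (s k).1); split=> // k /c [].
Qed.

Definition guarded (g : letter -> Prop) (L : lang) : lang :=
  fun x i j => g (x i) /\ L x i j.

Lemma recog_guarded g L : definable g -> recog L -> recog (guarded g L).
Proof.
move=> Dg RL.
(* Intersection with the words whose first letter satisfies [g]; as [conc] has nonempty factors,
   one-letter words are a separate case. *)
have R1 := recog_letter Dg; have RT := recog_all definable_True.
apply: recog_ext (recog_and (recog_or R1 (recog_conc R1 RT)) RL) => x i j ij.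
split; last first.
  case=> gi h; split=> //; have [e|ne] := eqVneq i j; [by left|right].
  by exists i; split=> //; lia.
by case=> -[[_ g1]|[a [_ [_ g1] _]]].
Qed.

End Automata.

(** * Complex events as clocked words *)

Section Semantics.
Variables (Ev Ty : Type) (Var : finType) (tv : Ty -> Var) (etype : Ev -> Ty)
          (PS : predsys etype).

Lemma tm_le (S : stream Ev) i j : valid_stream S -> 0 < i <= j -> j <= size S ->
  (tm S i <= tm S j)%R.
Proof.
move=> /andP[_ so]; case: i j => [//|i] [//|j] ij jS /=.
have E k : k < size S -> odflt 0%R (omap snd (onth S k)) = nth 0%R (map snd S) k.
  by move=> kS; rewrite -onth_map onthE (nth_map 0%R) ?size_map.
rewrite !E //; last lia.
have [->|ne] := eqVneq i j; first exact: lexx.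
apply: ltW; apply: (sorted_ltn_nth lt_trans) => //; rewrite ?inE ?size_map //; lia.
Qed.

Definition labs (mu : Var -> nat -> bool) (k : nat) : {set Var} := [set X | mu X k].

Lemma labs0P mu k : reflect (forall X, mu X k = false) (labs mu k == set0).
Proof.
apply: (iffP eqP) => [e X|e]; last by apply/setP => X; rewrite !inE e.
by have := in_set0 X; rewrite -e inE.
Qed.

(** Factors come from one fixed [mu] by moving the bounds, in step with words, which are also read
    on intervals. *)
Definition cut (mu : Var -> nat -> bool) (i j : nat) : ce Var :=
  CE i j (fun X k => (i <= k <= j) && mu X k).

Lemma labs_cut mu i j k : i <= k <= j -> labs (cmu (cut mu i j)) k = labs mu k.
Proof. by move=> h; apply/setP => X; rewrite !inE /= h. Qed.

Definition wfce (S : stream Ev) (C : ce Var) : Prop :=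
  [/\ 0 < cstart C, cstart C <= cend C, cend C <= size S &
      forall X k, cmu C X k -> cstart C <= k <= cend C].

Lemma ce_ext (C C' : ce Var) : cstart C = cstart C' -> cend C = cend C' ->
  (forall X k, cmu C X k = cmu C' X k) -> C = C'.
Proof.
case: C C' => i j mu [i' j' mu'] /= -> -> e; congr CE.
by apply: functional_extensionality => X; apply: functional_extensionality => k.
Qed.

Lemma cutK S C : wfce S C -> cut (cmu C) (cstart C) (cend C) = C.
Proof.
case=> _ _ _ h; apply: ce_ext => //= X k.
by case e: (cmu C X k); rewrite ?andbF // (h _ _ e).
Qed.

(* The clock values seen by a run on [i..j]: clock 0 measures the time elapsed
   since position i, clock 1 the time elapsed since the last marked position. *)
Definition compat (c0 c1 : bool) (S : stream Ev) mu (x : nat -> letter Ev Var) i j :=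
  forall k, i <= k <= j ->
    [/\ omap fst (onth S k.-1) = Some (lev (x k)), llab (x k) = labs mu k,
        c0 -> i < k -> lclk (x k) ord0 = Some (tm S k - tm S i)%R &
        c1 -> forall m, i <= m < k -> labs mu m != set0 ->
          (forall m', m < m' < k -> labs mu m' = set0) ->
          lclk (x k) ord_max = Some (tm S k - tm S m)%R].

(** Clock 0 is tied to the start [i] and has to be given up. The clause on clock 1 is inherited
    because it speaks only of marked positions inside the interval. *)
Lemma compat_sub c1 S mu x i j i' j' : i <= i' -> j' <= j ->
  compat false c1 S mu x i j -> compat false c1 S mu x i' j'.
Proof.
move=> hi hj h k hk; have [|h1 h2 _ h3] := h k; first lia.
by split=> // hc m hm; apply: h3 => //; lia.
Qed.

(** * Regular properties of complex events *)

Definition sprop := stream Ev -> ce Var -> Prop.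

Definition wfp (F : sprop) := forall S C, F S C -> wfce S C.

(** One language has to serve all streams. A flag [false] removes an assumption on the word and so
    makes the property stronger: the values of that clock may be arbitrary. *)
Definition regular (c0 c1 : bool) (F : sprop) : Prop :=
  exists L, recog PS L /\ forall S, valid_stream S -> forall mu x i j,
    0 < i <= j -> j <= size S -> compat c0 c1 S mu x i j ->
    F S (cut mu i j) <-> L x i j.

Lemma regular_ext c0 c1 (F F' : sprop) :
  (forall S C, F S C <-> F' S C) -> regular c0 c1 F -> regular c0 c1 F'.
Proof.
move=> E [L [R H]]; exists L; split=> // S vS mu x i j h1 h2 h3.
by rewrite -E; apply: H.
Qed.

Lemma regular_weaken (c0 c1 c0' c1' : bool) F : (c0 -> c0') -> (c1 -> c1') ->
  regular c0 c1 F -> regular c0' c1' F.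
Proof.
move=> e0 e1 [L [R H]]; exists L; split=> // S vS mu x i j h1 h2 h3.
apply: H => // k hk; have [? ? a b] := h3 k hk.
by split=> // [/e0|/e1].
Qed.

Lemma regular_or c0 c1 F G : regular c0 c1 F -> regular c0 c1 G ->
  regular c0 c1 (fun S C => F S C \/ G S C).
Proof.
move=> [L [R H]] [L' [R' H']].
exists (fun x i j => L x i j \/ L' x i j); split; first exact: recog_or.
by move=> S vS mu x i j h1 h2 h3; rewrite (H _ vS _ x) // (H' _ vS _ x).
Qed.

Lemma regular_and c0 c1 F G : regular c0 c1 F -> regular c0 c1 G ->
  regular c0 c1 (fun S C => F S C /\ G S C).
Proof.
move=> [L [R H]] [L' [R' H']].
exists (fun x i j => L x i j /\ L' x i j); split; first exact: recog_and.
by move=> S vS mu x i j h1 h2 h3; rewrite (H _ vS _ x) // (H' _ vS _ x).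
Qed.

Lemma regular_atom c0 c1 (R : Ty) : regular c0 c1 (fun S => sem tv S (FAtom Var PS R)).
Proof.
have D := definable_and (definable_den Var (ptype PS R))
                        (definable_lab PS (fun l => l == [set tv R])).
eexists; split; first exact: (recog_letter D).
move=> S vS mu x i j h1 h2 h3 /=; have [e l _ _] := h3 i ltac:(lia); split.
  case=> i' [i0 [[ev [he te]] [e1 e2 /(congr1 (fun f => f^~ i)) emu]]].
  split; first by rewrite e1 e2.
  move: he; rewrite -e1 e => -[eev]; split; first by apply/ptypeE; rewrite eev.
  rewrite l; apply/eqP/setP => X; rewrite !inE.
  have := congr1 (fun f => f X) emu; rewrite /= -e1 eqxx andbT => <-.
  by rewrite leqnn e2 -e1 leqnn.
case=> eij [/ptypeE te /eqP lR]; exists i; split; first lia.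
split; first by exists (lev (x i)).
apply: ce_ext => //= X k; rewrite -eij -eqn_leq eq_sym; have [->|] := eqVneq k i.
  rewrite /= andbT; have := congr1 (fun A : {set Var} => X \in A) lR.
  by rewrite l !inE.
by rewrite andbF.
Qed.

Lemma regular_filter c0 c1 X (p : pr PS) :
  regular c0 c1 (fun S C => forall k, cmu C X k -> evsat S k p).
Proof.
have D := definable_or (definable_lab PS (fun l : {set Var} => X \notin l))
                       (definable_den Var p).
eexists; split; first exact: (recog_all D).
move=> S vS mu x i j h1 h2 h3 /=; split=> h k.
  move=> hk; have [e l _ _] := h3 k hk; rewrite l inE.
  case: (boolP (mu X k)) => muk; [right|by left].
  have [_ [ev []]] : evsat S k p by apply: h; rewrite hk.
  by rewrite e => -[->].
case/andP=> hk muk; have [e l _ _] := h3 k hk.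
have := h k hk; rewrite l inE muk; case=> // hp; split; first lia.
by exists (lev (x k)).
Qed.

Lemma regular_window c1 (J : interval rat) :
  regular true c1 (fun S C => (tm S (cend C) - tm S (cstart C))%R \in J).
Proof.
(* On the first letter of a run clock 0 is still undefined; for a one-letter word the duration is
   [0], and membership in [J] is decided in advance. *)
have R1 := recog_letter (definable_bool Var PS (0%R \in J)).
have R2 := recog_conc (recog_all (definable_True Var PS))
                      (recog_letter (definable_clkin Var PS ord0 J)).
eexists; split; first exact: (recog_or R1 R2).
move=> S vS mu x i j h1 h2 h3 /=.
have [e|ne] := eqVneq i j.
  rewrite e subrr; split; first by left.
  by case=> [[]|[a []]] //; lia.
have [_ _ c _] := h3 j ltac:(lia); have {}c := c isT ltac:(lia).
split=> h.
  right; exists j.-1; rewrite prednK; last lia.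
  split=> //; first lia.
  split=> //; exists (tm S j - tm S i)%R; split=> //.
  by rewrite subr_ge0; apply: tm_le.
case: h => [[]|[a [_ _ [ea [v []]]]]]; first by move/eqP: ne.
by rewrite ea c => -[->].
Qed.

Definition mapce (f : {set Var} -> {set Var}) (C : ce Var) : ce Var :=
  CE (cstart C) (cend C) (fun X k => X \in f (labs (cmu C) k)).

(** [f set0 = set0] keeps marks inside the interval of the complex event. If clock 1 is assumed
    correct, [f] must also keep every nonempty label nonempty, so that the guessed original labels
    induce the same resets. *)
Lemma regular_map (c0 c1 : bool) (f : {set Var} -> {set Var}) F : f set0 = set0 ->
  (c1 -> forall l, (f l == set0) = (l == set0)) -> wfp F -> regular c0 c1 F ->
  regular c0 c1 (fun S C => exists C', F S C' /\ C = mapce f C').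
Proof.
move=> f0 f1 wfF [L [R H]]; eexists; split; first exact: (recog_relabel f R).
move=> S vS mu x i j h1 h2 h3 /=.
have tr (l : nat -> {set Var}) : (forall k, i <= k <= j -> f (l k) = labs mu k) ->
    compat c0 c1 S (fun X k => X \in l k) (fun k => relabel (x k) (l k)) i j.
  have ll k : labs (fun X k => X \in l k) k = l k by apply/setP => X; rewrite inE.
  move=> fl k hk; have [a b c d] := h3 k hk; split=> //.
  move=> hc m hm; rewrite ll => ml gap; apply: d => //.
    by rewrite -fl ?f1 //; lia.
  by move=> m' hm'; rewrite -fl ?(gap _ hm') -?ll ?gap //; lia.
split.
  case=> C' [FC' [e1 e2 e3]].
  have lab k : i <= k <= j -> f (labs (cmu C') k) = labs mu k.
    move=> hk; apply/setP => X; rewrite inE.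
    by have := congr1 (fun f => f X k) e3; rewrite /= hk.
  exists (labs (cmu C')); split.
    by move=> k hk; have [_ -> _ _] := h3 k hk; apply: lab.
  apply/(H S vS _ _ _ _ h1 h2 (tr _ lab)).
  suff -> : cut (fun X k => X \in labs (cmu C') k) i j = C' by [].
  rewrite -[RHS](cutK (wfF _ _ FC')) e1 e2; apply: ce_ext => // X k /=.
  by rewrite inE.
case=> l [fl LL].
have fl' k : i <= k <= j -> f (l k) = labs mu k.
  by move=> hk; rewrite fl //; have [] := h3 k hk.
exists (cut (fun X k => X \in l k) i j); split.
  exact/(H S vS _ _ _ _ h1 h2 (tr _ fl')).
apply: ce_ext => //= X k; case hk: (i <= k <= j) => /=.
  have -> : labs (fun X k => (i <= k <= j) && (X \in l k)) k = l k.
    by apply/setP => Y; rewrite inE hk.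
  by rewrite fl' // inE.
have -> : labs (fun X k => (i <= k <= j) && (X \in l k)) k = set0.
  by apply/setP => Y; rewrite !inE hk.
by rewrite f0 inE.
Qed.

(** The marks of a factor lie in its own interval and the two intervals are disjoint, so both
    factors are cuts of the common [mu]. Only the two cut points are left to find, with no mark
    strictly between them. *)
Lemma seqcomb_cut S mu i j cond (P Q : ce Var -> Prop) :
  (forall a b, cond a b -> a < b) ->
  (forall C, P C -> wfce S C) -> (forall C, Q C -> wfce S C) ->
  seqcomb cond P Q (cut mu i j) <->
  exists a b, [/\ i <= a < b, b <= j, (forall k, a < k < b -> labs mu k = set0),
                  P (cut mu i a) /\ Q (cut mu b j) & cond a b].
Proof.
move=> hc wP wQ; split; last first.
  case=> a [b [iab bj gap [PC QC] cab]]; exists (cut mu i a), (cut mu b j); split=> //.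
  apply: ce_ext => /= [||X k]; [lia|lia|].
  have [hk|hk] := boolP (a < k < b).
    by have /eqP/labs0P -> := gap k hk; rewrite !andbF.
  rewrite -andb_orl; congr andb; lia.
case=> C1 [C2 [PC QC /[dup] cC /hc lt]].
have [w1 w2 w3 w4] := wP _ PC; have [w1' w2' w3' w4'] := wQ _ QC.
case=> e1 e2 e3.
have ei : i = cstart C1 by lia.
have ej : j = cend C2 by lia.
have E X k : i <= k <= j -> mu X k = cmu C1 X k || cmu C2 X k.
  by move=> hk; have := congr1 (fun f => f X k) e3; rewrite /= hk.
have F1 X k : k < cstart C1 \/ cend C1 < k -> cmu C1 X k = false.
  by move=> hk; apply/negP => /w4; lia.
have F2 X k : k < cstart C2 \/ cend C2 < k -> cmu C2 X k = false.
  by move=> hk; apply/negP => /w4'; lia.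
exists (cend C1), (cstart C2); split=> //; [lia|lia| |].
  move=> k hk; apply/eqP/labs0P => X; rewrite E; last lia.
  by rewrite F1 ?F2 //; lia.
split.
  suff -> : cut mu i (cend C1) = C1 by [].
  rewrite -{2}(cutK (wP _ PC)) -ei; apply: ce_ext => //= X k.
  case hk: (i <= k <= cend C1) => //=; rewrite E; last lia.
  by rewrite F2 ?orbF //; lia.
suff -> : cut mu (cstart C2) j = C2 by [].
rewrite -{2}(cutK (wQ _ QC)) -ej; apply: ce_ext => //= X k.
case hk: (cstart C2 <= k <= j) => //=; rewrite E; last lia.
by rewrite F1 //; lia.
Qed.

Lemma seqcomb_wf S cond (P Q : ce Var -> Prop) :
  (forall C, P C -> wfce S C) -> (forall C, Q C -> wfce S C) ->
  forall C, seqcomb cond P Q C -> wfce S C.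
Proof.
move=> wP wQ C [C1 [C2 [/wP [w1 w2 w3 w4] /wQ [w1' w2' w3' w4'] _ ->]]].
split=> /=; [lia|lia|lia|move=> X k /orP[/w4|/w4']; lia].
Qed.

Lemma itercomb_wf S cond (P : ce Var -> Prop) m :
  (forall C, P C -> wfce S C) -> forall C, itercomb cond P m C -> wfce S C.
Proof.
by move=> wP; elim: m => [//|m IH]; apply: seqcomb_wf.
Qed.

Definition inJ (J : option (interval rat)) (v : rat) : bool :=
  if J is Some J' then v \in J' else true.

(** Common form of the conditions of the four sequencing operators: [nx] asks for adjacency, [J] is
    the optional interval. *)
Definition gcond (S : stream Ev) (nx : bool) J (a b : nat) : Prop :=
  (if nx then a.+1 == b else a < b) /\ inJ J (tm S b - tm S a)%R.

Definition guardJ (J : option (interval rat)) (x : letter Ev Var) : Prop :=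
  if J is Some J' then clkin ord_max J' x else True.

Lemma definable_guardJ J : definable PS (guardJ J).
Proof. by case: J => [J|]; [apply: definable_clkin|apply: definable_True]. Qed.

(** The unmarked gap is attached to the factor that follows it, so that sequencing becomes plain
    concatenation of adjacent words. The interval is tested on the first letter after the gap. *)
Definition gapped (nx : bool) J (L : lang Ev Var) : lang Ev Var := fun x i j =>
  exists b, [/\ i <= b <= j, nx -> b = i,
    forall k, i <= k < b -> llab (x k) = set0 & guarded (guardJ J) L x b j].

Lemma recog_gapped nx J L : recog PS L -> recog PS (gapped nx J L).
Proof.
move=> /(recog_guarded (definable_guardJ J)) RL; case: nx.
  apply: recog_ext RL => x i j ij; split=> [h|[b [_ -> //]]].
  by exists i; split=> //; lia.
have RG := recog_all (definable_lab PS (fun l : {set Var} => l == set0)).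
apply: recog_ext (recog_or RL (recog_conc RG RL)) => x i j ij; split.
  case=> [h|[a [ha hg h]]]; first by exists i; split=> //; lia.
  by exists a.+1; split=> // [|k hk]; [lia|apply/eqP/hg; lia].
case=> b [hb _ hg h]; have [e|ne] := eqVneq i b; first by left; rewrite e.
right; exists b.-1; split; first lia.
  by move=> k hk; apply/eqP/hg; lia.
by rewrite prednK //; lia.
Qed.

Definition endmarked (F : sprop) :=
  forall S C, F S C -> labs (cmu C) (cend C) != set0.

(** * Sequencing and iteration, with or without an interval *)

Section Chop.
Variables (c1 nx : bool) (J : option (interval rat)) (F : sprop).
Variable cond : stream Ev -> nat -> nat -> Prop.
Hypothesis condE : forall S a b, cond S a b <-> gcond S nx J a b.
(** Demands something only if an interval is tested. With [J = None] the results below also cover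
    formulas with projections. *)
Hypothesis mk : J -> c1 /\ endmarked F.
Hypothesis wF : wfp F.

Lemma cond_lt S a b : cond S a b -> a < b.
Proof. by rewrite condE => -[]; case: nx => // /eqP->. Qed.

(* The end [a] of the first factor is the last marked position before [b]. *)
Lemma guardJE S mu x i j a b : valid_stream S -> 0 < i <= a -> a < b <= j ->
  j <= size S -> compat false c1 S mu x i j -> F S (cut mu i a) ->
  (forall k, a < k < b -> labs mu k = set0) ->
  guardJ J (x b) <-> inJ J (tm S b - tm S a)%R.
Proof.
move=> vS h1 h2 h3 h4 FC gap; case: J mk => [J'|//] /(_ isT) [hc em] /=.
have [_ _ _ d] := h4 b ltac:(lia).
have {}d : lclk (x b) ord_max = Some (tm S b - tm S a)%R.
  apply: d => //; first lia.
  by have := em _ _ FC; rewrite /= labs_cut //; lia.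
split; first by case=> v []; rewrite d => -[->].
move=> h; exists (tm S b - tm S a)%R; split=> //.
by rewrite subr_ge0; apply: tm_le => //; lia.
Qed.

Lemma gap_cond S mu x i j a b : valid_stream S -> 0 < i <= a -> a < b <= j ->
  j <= size S -> compat false c1 S mu x i j -> F S (cut mu i a) ->
  (forall k, a < k < b -> labs mu k = set0) ->
  cond S a b <-> (nx -> b = a.+1) /\ guardJ J (x b).
Proof.
move=> vS h1 h2 h3 h4 FC gap; rewrite (guardJE vS h1 h2 h3 h4 FC gap) condE /gcond.
case: nx; split=> -[n ?]; split=> //; first by move=> _; rewrite (eqP n).
  by rewrite n.
lia.
Qed.

Lemma regular_seq G : wfp G -> regular false c1 F -> regular false c1 G ->
  regular false c1 (fun S => seqcomb (cond S) (F S) (G S)).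
Proof.
move=> wG [L1 [R1 H1]] [L2 [R2 H2]].
eexists; split; first exact: (recog_conc R1 (recog_gapped nx J R2)).
move=> S vS mu x i j h1 h2 h3.
rewrite (seqcomb_cut _ _ _ (@cond_lt S) (@wF S) (wG S)); split.
  case=> a [b [iab bj gap [FC GC] cab]].
  have := cab; rewrite (gap_cond vS _ _ h2 h3 FC gap); [|lia|lia].
  case=> hn hg; exists a; split; first lia.
    by apply/(H1 _ vS mu) => //; [lia|lia|apply: compat_sub h3; lia].
  exists b; split=> //; first lia.
    by move=> k hk; have [_ -> _ _] := h3 k ltac:(lia); apply: gap; lia.
  split=> //; apply/(H2 _ vS mu) => //; [lia|apply: compat_sub h3; lia].
case=> a [iaj La [b [hb hn gap [hg Lb]]]].
have gap' k : a < k < b -> labs mu k = set0.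
  by move=> hk; have [_ <- _ _] := h3 k ltac:(lia); apply: gap; lia.
have FC : F S (cut mu i a).
  by apply/(H1 _ vS mu x) => //; [lia|lia|apply: compat_sub h3; lia].
exists a, b; split=> //; [lia|lia| |].
  split=> //; apply/(H2 _ vS mu x) => //; [lia|apply: compat_sub h3; lia].
by rewrite (gap_cond vS _ _ h2 h3 FC gap') //; lia.
Qed.

Lemma regular_plus : regular false c1 F ->
  regular false c1 (fun S => pluscomb (cond S) (F S)).
Proof.
move=> [L [R H]].
have RI := recog_iter (recog_gapped nx J R).
eexists; split; first exact: (recog_or R (recog_conc R RI)).
move=> S vS mu x i j h1 h2 h3; split.
  case=> m; elim: m => [|m IH] in i h1 h3 *.
    by move=> FC; left; apply/(H _ vS mu).
  have wI := itercomb_wf (cond := cond S) (m := m) (@wF S).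
  rewrite /= (seqcomb_cut _ _ _ (@cond_lt S) (@wF S) wI).
  case=> a [b [iab bj gap [FC GC] cab]].
  have := cab; rewrite (gap_cond vS _ _ h2 h3 FC gap); [|lia|lia].
  case=> hn hg; right; exists a; split; first lia.
    by apply/(H _ vS mu) => //; [lia|lia|apply: compat_sub h3; lia].
  have gap' k : a.+1 <= k < b -> llab (x k) = set0.
    by move=> hk; have [_ -> _ _] := h3 k ltac:(lia); apply: gap; lia.
  have [||Lb|[a2 [ha2 Lb I]]] := IH b _ _ GC; first lia.
  - by apply: compat_sub h3; lia.
  - by apply: iterL_one; [lia|exists b; split=> //; lia].
  - apply: (iterL_more (a := a2)) I; first lia.
    by exists b; split=> //; lia.
case=> [LL|[a [iaj La I]]].
  by exists 0; apply/(H _ vS mu x).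
have FC : F S (cut mu i a).
  by apply/(H _ vS mu x) => //; [lia|lia|apply: compat_sub h3; lia].
(* Puts one more factor in front of an iteration, turning the guard on the letter at [b] back into a
   condition on the times at [a'] and [b]. *)
have glue i' a' b m : i <= i' -> i' <= a' < b -> b <= j -> F S (cut mu i' a') ->
    (nx -> b = a'.+1) -> (forall k, a'.+1 <= k < b -> llab (x k) = set0) ->
    guardJ J (x b) -> itercomb (cond S) (F S) m (cut mu b j) ->
    itercomb (cond S) (F S) m.+1 (cut mu i' j).
  move=> ii iab bj FC' hn gap hg Im /=.
  have gap' k : a' < k < b -> labs mu k = set0.
    by move=> hk; have [_ <- _ _] := h3 k ltac:(lia); apply: gap; lia.
  have wI := itercomb_wf (cond := cond S) (m := m) (@wF S).
  rewrite (seqcomb_cut _ _ _ (@cond_lt S) (@wF S) wI).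
  exists a', b; split=> //.
  have h3' : compat false c1 S mu x i' j by apply: compat_sub h3; lia.
  by rewrite (gap_cond vS _ _ h2 h3' FC' gap') //; lia.
have FL b a' : i <= b <= a' -> a' <= j -> L x b a' -> F S (cut mu b a').
  by move=> hb ha Lb; apply/(H _ vS mu x) => //; [lia|lia|apply: compat_sub h3; lia].
(* The induction carries the preceding factor [i'..a'] along, since the guard of a gapped factor
   measures the time from the end of that factor. *)
suff K i0 : iterL (gapped nx J L) x j i0 -> forall i' a', a'.+1 = i0 -> i <= i' <= a' ->
    F S (cut mu i' a') -> exists m, itercomb (cond S) (F S) m (cut mu i' j).
  by apply: (K _ I i a) => //; lia.
elim=> {I i0} i0.
  move=> i0j [b [hb hn gap [hg Lb]]] i' a' e hi FC'; rewrite -e in i0j hb hn gap.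
  exists 1; apply: (glue _ a' b) => //; [lia|lia|lia|].
  by apply: FL => //; lia.
move=> a2 ha2 [b [hb hn gap [hg Lb]]] _ IH i' a' e hi FC'; rewrite -e in ha2 hb hn gap.
have [m Im] : exists m, itercomb (cond S) (F S) m (cut mu b j).
  by apply: (IH b a2) => //; [lia|apply: FL => //; lia].
by exists m.+1; apply: (glue _ a' b) => //; lia.
Qed.
End Chop.

(** * Regularity of the formulas *)

Local Notation form := (tform Var PS).

Lemma sem_wf (f : form) : wfp (fun S => sem tv S f).
Proof.
have pw S cond (P : ce Var -> Prop) C :
    (forall C, P C -> wfce S C) -> pluscomb cond P C -> wfce S C.
  by move=> wP [m]; apply: itercomb_wf.
elim: f => [R|f IH X|f IH X p|f IHf g IHg|f IHf g IHg|f IHf g IHg|f IHf g IHg|f IH|f IH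
  |L f IH|f IH J|J f IHf g IHg|J f IHf g IHg|J f IH|J f IH] S C /=.
- case=> i [i0 [[e [he _]] ->]]; split=> //=; last by move=> X k /andP[_ /eqP->]; lia.
  have := onthTE S i.-1; case: (onth S i.-1) he => // a _ /=; lia.
- case=> C' [/IH [w1 w2 w3 w4] ->]; split=> //= Y k.
  by case: eqP => _; [case/existsP=> Y'|]; apply: w4.
- by case=> /IH.
- by case=> [/IHf|/IHg].
- by case=> /IHf.
- exact: seqcomb_wf (IHf S) (IHg S) C.
- exact: seqcomb_wf (IHf S) (IHg S) C.
- exact: pw (IH S).
- exact: pw (IH S).
- by case=> C' [/IH [w1 w2 w3 w4] ->]; split=> //= Y k /andP[_]; apply: w4.
- by case=> /IH.
- exact: seqcomb_wf (IHf S) (IHg S) C.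
- exact: seqcomb_wf (IHf S) (IHg S) C.
- exact: pw (IH S).
- exact: pw (IH S).
Qed.

(** An atom marks its only position, a sequence or iteration ends where its last factor ends, and AS
    puts [X] wherever anything is marked. The remaining operators only select among or combine
    existing outputs. *)
Lemma sem_endmarked (f : form) : simple f -> endmarked (fun S => sem tv S f).
Proof.
have sw S cond (P Q : ce Var -> Prop) C : (forall C, P C -> wfce S C) ->
    (forall C, Q C -> wfce S C /\ labs (cmu C) (cend C) != set0) ->
    (forall a b, cond a b -> a < b) ->
    seqcomb cond P Q C -> labs (cmu C) (cend C) != set0.
  move=> wP wQ hc [C1 [C2 [/wP [_ w2 _ _] /wQ [[_ w2' _ _] /set0Pn [X]]]]].
  rewrite inE => hX /hc lt ->; apply/set0Pn; exists X; rewrite inE /=.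
  have -> : maxn (cend C1) (cend C2) = cend C2 by lia.
  by rewrite hX orbT.
have pw S cond (P : ce Var -> Prop) C :
    (forall C, P C -> wfce S C /\ labs (cmu C) (cend C) != set0) ->
    (forall a b, cond a b -> a < b) ->
    pluscomb cond P C -> labs (cmu C) (cend C) != set0.
  move=> wP hc [m]; have wP' C' (h : P C') := (wP C' h).1.
  elim: m C => [|m IH] C /=; first by case/wP.
  apply: (sw S) => // C' h; split; last exact: IH.
  exact: itercomb_wf wP' _ h.
have c1 a b : c_seq a b -> a < b by [].
have c2 a b : c_next a b -> a < b by move=> <-.
have c3 S J a b : c_seqI (Ev := Ev) S J a b -> a < b by case.
have c4 S J a b : c_nextI (Ev := Ev) S J a b -> a < b by case=> <-.
have we (g : form) S : endmarked (fun S => sem tv S g) -> forall C, sem tv S g C ->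
    wfce S C /\ labs (cmu C) (cend C) != set0.
  by move=> em C h; split; [apply: sem_wf h|apply: em h].
elim: f => [R|f IH X|f IH X p|f IHf g IHg|f IHf g IHg|f IHf g IHg|f IHf g IHg|f IH|f IH
  |L f IH|f IH J|J f IHf g IHg|J f IHf g IHg|J f IH|J f IH] //= sf S C.
- case=> i [_ [_ ->]] /=; apply/set0Pn; exists (tv R); by rewrite inE !eqxx.
- case=> C' [/(IH sf)/set0Pn [Y]]; rewrite inE => hY -> /=.
  apply/set0Pn; exists X; rewrite inE eqxx; by apply/existsP; exists Y.
- by case=> /(IH sf).
- by case/andP: sf => sf sg; case=> [/(IHf sf)|/(IHg sg)].
- by case/andP: sf => sf sg; case=> /(IHf sf).
- case/andP: sf => sf sg; apply: (sw S) (c1) => //; [exact: sem_wf|exact: we (IHg sg)].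
- case/andP: sf => sf sg; apply: (sw S) (c2) => //; [exact: sem_wf|exact: we (IHg sg)].
- by apply: (pw S) (c1); apply: we (IH sf).
- by apply: (pw S) (c2); apply: we (IH sf).
- case/andP: sf => sf sg; apply: (sw S) (c3 S J) => //; [exact: sem_wf|exact: we (IHg sg)].
- case/andP: sf => sf sg; apply: (sw S) (c4 S J) => //; [exact: sem_wf|exact: we (IHg sg)].
- by apply: (pw S) (c3 S J); apply: we (IH sf).
- by apply: (pw S) (c4 S J); apply: we (IH sf).
Qed.

Definition as_lab (X : Var) (l : {set Var}) : {set Var} :=
  [set Y | if Y == X then l != set0 else Y \in l].

Lemma as_lab0 X : as_lab X set0 = set0.
Proof. by apply/setP => Y; rewrite !inE eqxx; case: eqP. Qed.

(* Renaming does not change the set of marked positions, whereas projection may. *)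
Lemma as_lab_eq0 X l : (as_lab X l == set0) = (l == set0).
Proof.
have [->|ne] := eqVneq l set0; first by rewrite as_lab0 eqxx.
by apply/negbTE/set0Pn; exists X; rewrite inE eqxx.
Qed.

Lemma regular_as c0 c1 (f : form) X : regular c0 c1 (fun S => sem tv S f) ->
  regular c0 c1 (fun S => sem tv S (FAs f X)).
Proof.
move=> R.
apply: regular_ext (regular_map (as_lab0 X) (fun _ => as_lab_eq0 X) (@sem_wf f) R).
have E C' : mapce (as_lab X) C' = CE (cstart C') (cend C')
    (fun Y k => if Y == X then [exists Y', cmu C' Y' k] else cmu C' Y k).
  apply: ce_ext => //= Y k; rewrite !inE; case: eqP => // _.
  apply/set0Pn/existsP => -[Z hZ]; exists Z; by rewrite inE in hZ *.
by move=> S C /=; split=> -[C' [h ->]]; exists C'; rewrite E.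
Qed.

Lemma regular_proj c0 (f : form) L : regular c0 false (fun S => sem tv S f) ->
  regular c0 false (fun S => sem tv S (FProj L f)).
Proof.
move=> R; have f0 : L :&: set0 = set0 by rewrite setI0.
apply: regular_ext (regular_map (f := fun l => L :&: l) f0 _ (@sem_wf f) R) => // S C /=.
have E C' : mapce (fun l => L :&: l) C' = CE (cstart C') (cend C')
    (fun X k => (X \in L) && cmu C' X k).
  by apply: ce_ext => //= Y k; rewrite !inE.
by split=> -[C' [h ->]]; exists C'; rewrite E.
Qed.

Lemma regular_no_time (f : form) : no_time f -> regular false false (fun S => sem tv S f).
Proof.
have E1 (S : stream Ev) a b : c_seq a b <-> gcond S false None a b.
  by rewrite /gcond; split=> [|[]].
have E2 (S : stream Ev) a b : c_next a b <-> gcond S true None a b.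
  by rewrite /gcond /c_next; split=> [->|[/eqP]].
have mk F : (None : option (interval rat)) -> false /\ endmarked F by [].
elim: f => [R|f IH X|f IH X p|f IHf g IHg|f IHf g IHg|f IHf g IHg|f IHf g IHg|f IH|f IH
  |L f IH|f IH J|J f IHf g IHg|J f IHf g IHg|J f IH|J f IH] //=.
- by move=> _; apply: regular_atom.
- by move=> /IH; apply: regular_as.
- by move=> /IH R; apply: regular_and R (regular_filter _ _ _ _).
- by move=> /andP[/IHf R /IHg R']; apply: regular_or.
- by move=> /andP[/IHf R /IHg R']; apply: regular_and.
- move=> /andP[/IHf R /IHg R'].
  exact: (regular_seq E1 (mk _) (@sem_wf f) (@sem_wf g) R R').
- move=> /andP[/IHf R /IHg R'].
  exact: (regular_seq E2 (mk _) (@sem_wf f) (@sem_wf g) R R').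
- by move=> /IH; apply: (regular_plus E1 (mk _) (@sem_wf f)).
- by move=> /IH; apply: (regular_plus E2 (mk _) (@sem_wf f)).
- by move=> /IH; apply: regular_proj.
Qed.

Lemma regular_simple (f : form) : simple f -> regular false true (fun S => sem tv S f).
Proof.
have E1 (S : stream Ev) a b : c_seq a b <-> gcond S false None a b.
  by rewrite /gcond; split=> [|[]].
have E2 (S : stream Ev) a b : c_next a b <-> gcond S true None a b.
  by rewrite /gcond /c_next; split=> [->|[/eqP]].
have E3 J (S : stream Ev) a b : c_seqI S J a b <-> gcond S false (Some J) a b by [].
have E4 J (S : stream Ev) a b : c_nextI S J a b <-> gcond S true (Some J) a b.
  by rewrite /gcond; split=> -[e h]; split=> //; apply/eqP.
have mk J (g : form) : simple g -> (J : option (interval rat)) ->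
    true /\ endmarked (fun S => sem tv S g).
  by move=> sg _; split=> //; apply: sem_endmarked.
elim: f => [R|f IH X|f IH X p|f IHf g IHg|f IHf g IHg|f IHf g IHg|f IHf g IHg|f IH|f IH
  |L f IH|f IH J|J f IHf g IHg|J f IHf g IHg|J f IH|J f IH] //= sf.
- exact: regular_atom.
- exact: regular_as (IH sf).
- exact: regular_and (IH sf) (regular_filter _ _ _ _).
- by case/andP: sf => /IHf R /IHg R'; apply: regular_or.
- by case/andP: sf => /IHf R /IHg R'; apply: regular_and.
- case/andP: sf => sf sg.
  exact: (regular_seq E1 (mk _ _ sf) (@sem_wf f) (@sem_wf g) (IHf sf) (IHg sg)).
- case/andP: sf => sf sg.
  exact: (regular_seq E2 (mk _ _ sf) (@sem_wf f) (@sem_wf g) (IHf sf) (IHg sg)).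
- exact: (regular_plus E1 (mk _ _ sf) (@sem_wf f) (IH sf)).
- exact: (regular_plus E2 (mk _ _ sf) (@sem_wf f) (IH sf)).
- case/andP: sf => sf sg.
  exact: (regular_seq (E3 J) (mk _ _ sf) (@sem_wf f) (@sem_wf g) (IHf sf) (IHg sg)).
- case/andP: sf => sf sg.
  exact: (regular_seq (E4 J) (mk _ _ sf) (@sem_wf f) (@sem_wf g) (IHf sf) (IHg sg)).
- exact: (regular_plus (E3 J) (mk _ _ sf) (@sem_wf f) (IH sf)).
- exact: (regular_plus (E4 J) (mk _ _ sf) (@sem_wf f) (IH sf)).
Qed.

(** No sequencing occurs above a window, so the start of the windowed complex event is that of the
    whole run, which is what clock 0 measures. *)
Lemma regular_windowed (f : form) : windowed f -> regular true true (fun S => sem tv S f).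
Proof.
have base (g : form) : no_time g || simple g -> regular true true (fun S => sem tv S g).
  by case/orP=> [/regular_no_time|/regular_simple]; apply: regular_weaken.
have wE (g : form) : windowed g = (no_time g || simple g) || match g with
    | FAs h _ | FFilter h _ _ | FWin h _ => windowed h
    | FOr h k | FAnd h k => windowed h && windowed k
    | _ => false
    end by rewrite -orbA; case: g.
elim: f => [R|f IH X|f IH X p|f IHf g IHg|f IHf g IHg|f IHf g IHg|f IHf g IHg|f IH|f IH
  |L f IH|f IH J|J f IHf g IHg|J f IHf g IHg|J f IH|J f IH];
  rewrite wE => /orP[/base //|] //.
- by move/IH; apply: regular_as.
- by move/IH => R; apply: regular_and R (regular_filter _ _ _ _).
- by case/andP=> /IHf R /IHg R'; apply: regular_or.
- by case/andP=> /IHf R /IHg R'; apply: regular_and.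
- by move/IH => R; apply: regular_and R (regular_window _ _).
Qed.

End Semantics.

(** * From finite automata to timed automata with two clocks *)

Section Compile.
Variables (Ev Ty : Type) (Var : finType) (etype : Ev -> Ty) (PS : predsys etype).
Variable N : nfa Var PS.
Variable al : st N -> st N -> seq (atom Var PS).
Hypothesis al_wf : forall q q' a, List.In a (al q q') -> ccond_wf a.1.2.
Hypothesis alE : forall q q' x, stp q x q' <-> exists a, List.In a (al q q') /\ asat x a.

Definition resets (first : bool) (l : {set Var}) : {set clock} :=
  [set z : clock | (z == ord0) && first || (z == ord_max) && (l != set0)].

(* State 0 is a fresh initial state without incoming transitions. *)
Definition code (q : st N) : nat := (enum_rank q).+1.

Lemma code_inj : injective code.
Proof. by move=> q q' [] /val_inj /enum_rank_inj. Qed.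

Definition inner_trans q (a : atom Var PS) q' : trans Var PS :=
  Trans (code q) a.1.1 a.1.2 a.2 (resets false a.2) (code q').

Definition first_trans (a : atom Var PS) q' : trans Var PS :=
  Trans 0 a.1.1 a.1.2 a.2 (resets true a.2) (code q').

Definition delta : seq (trans Var PS) :=
  List.flat_map (fun qq : st N * st N =>
    List.flat_map (fun a => inner_trans qq.1 a qq.2 ::
                      (if ini qq.1 then [:: first_trans a qq.2] else [::]))
      (al qq.1 qq.2)) (enum {: st N * st N}).

Definition compiled : tcea Var PS :=
  TCEA delta 0 [seq code q | q <- enum (fin (n := N))].

Lemma in_delta d : List.In d delta <-> exists q q' a, List.In a (al q q') /\
  (d = inner_trans q a q' \/ ini q /\ d = first_trans a q').
Proof.
rewrite /delta List.in_flat_map; split.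
  case=> -[q q'] [_ /List.in_flat_map [a [ia h]]]; exists q, q', a; split=> //.
  case: h => [<-|]; first by left.
  by rewrite /=; case: (ini q) => // -[<-|[]] //; right.
case=> q [q' [a [ia h]]]; exists (q, q'); split; first exact: In_enum.
apply/List.in_flat_map; exists a; split=> //=.
by case: h => [->|[-> ->]]; [left|right; left].
Qed.

Lemma compiled_wf : tcea_wf compiled.
Proof. by move=> d /in_delta [q [q' [a [/al_wf wa [->|[_ ->]]]]]]. Qed.

Lemma delta_reset d : List.In d delta ->
  treset d = resets (tsrc d == 0) (tlab d) /\ tdst d != 0.
Proof. by move=> /in_delta [q [q' [a [_ [->|[_ ->]]]]]]. Qed.

(** The two runs may be in different states; a reset set depends only on the label and on whether
    the source is the initial state, which is never entered again. *)
Lemma run_sync S i p p' nu nu' rs rs' : (p == 0) = (p' == 0) ->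
  run compiled S i p nu rs -> run compiled S i p' nu' rs' ->
  size rs = size rs' -> map (@tlab _ _ _ _ PS) rs = map (@tlab _ _ _ _ PS) rs' ->
  map (@treset _ _ _ _ PS) rs = map (@treset _ _ _ _ PS) rs'.
Proof.
elim: rs rs' i p p' nu nu' => [|d rs IH] [|d' rs'] //= i p p' nu nu' ep.
case=> /delta_reset [rd nd] sd _ _ h [/delta_reset [rd' nd'] sd' _ _ h'].
case=> es [el els]; rewrite rd rd' sd sd' ep el; congr cons.
by apply: IH h h' es els; rewrite (negbTE nd) (negbTE nd').
Qed.

Lemma compiled_sync : sync_resets compiled.
Proof. by move=> S _ i rs rs' _; apply: run_sync. Qed.

(** * Runs of the compiled automaton and paths of the finite automaton *)

Variables (S : stream Ev) (e0 : Ev) (i : nat) (lb : nat -> {set Var}).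

(* The clock values before position [i + n] in any run from [i] labelled by [lb]. *)
Fixpoint clkval (n : nat) : cval :=
  if n is n'.+1 then
    vreset (resets (n' == 0) (lb (i + n')))
           (vshift (clkval n') (tm S (i + n') - tm S (i + n').-1)%R)
  else vundef.

(** The word that a run from [i] labelled [lb] really reads: clocks are taken after the time shift,
    as guards see them. The event [e0] is used only outside the stream. *)
Definition xcan (k : nat) : letter Ev Var :=
  Letter (odflt e0 (omap fst (onth S k.-1)))
         (vshift (clkval (k - i)) (tm S k - tm S k.-1)%R) (lb k).

Lemma ord0_max : (ord0 == ord_max :> clock) = false. Proof. by []. Qed.

Lemma vshift_clkvalS n t z : vshift (clkval n.+1) t z =
  omap (fun v => v + t)%R (if z \in resets (n == 0) (lb (i + n)) then Some 0%R
    else vshift (clkval n) (tm S (i + n) - tm S (i + n).-1)%R z).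
Proof. by []. Qed.

Lemma clkval_start n :
  vshift (clkval n.+1) (tm S (i + n.+1) - tm S (i + n))%R ord0 =
  Some (tm S (i + n.+1) - tm S i)%R.
Proof.
elim: n => [|n IH]; rewrite vshift_clkvalS inE eqxx.
  by congr Some; rewrite addn0 add0r.
rewrite ord0_max; have -> : (i + n.+1).-1 = i + n by lia.
by rewrite IH; congr Some; rewrite addrC subrKA.
Qed.

Lemma clkval_marked m n : m <= n -> lb (i + m) != set0 ->
  (forall m', m < m' <= n -> lb (i + m') = set0) ->
  vshift (clkval n.+1) (tm S (i + n.+1) - tm S (i + n))%R ord_max =
  Some (tm S (i + n.+1) - tm S (i + m))%R.
Proof.
move=> mn lm; elim: n mn => [|n IH] mn gap; rewrite vshift_clkvalS inE.
  have em : m = 0 by lia.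
  by rewrite em in lm *; rewrite lm orbT; congr Some; rewrite add0r.
have [em|ne] := eqVneq m n.+1.
  by rewrite em in lm *; rewrite lm orbT; congr Some; rewrite add0r.
rewrite (gap n.+1) ?eqxx; last lia.
have -> : (i + n.+1).-1 = i + n by lia.
rewrite IH; [|lia|by move=> m' hm'; apply: gap; lia].
by congr Some; rewrite addrC subrKA.
Qed.

(** Here the hypothesis [compat] is discharged: the differences of consecutive times added since a
    reset telescope to the elapsed time. *)
Lemma compat_xcan j mu : 0 < i -> j <= size S -> lb =1 labs mu ->
  compat true true S mu xcan i j.
Proof.
move=> i0 jS lbE k hk; split=> /=.
- by have := onthTE S k.-1; case: (onth S k.-1) => //=; lia.
- exact: lbE.
- move=> _ ik; have := clkval_start (k - i).-1.
  have -> : (k - i).-1.+1 = k - i by lia.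
  have -> : i + (k - i) = k by lia.
  by have -> : i + (k - i).-1 = k.-1 by lia.
- move=> _ m hm lm gap; have := @clkval_marked (m - i) (k - i).-1.
  have -> : (k - i).-1.+1 = k - i by lia.
  have -> : i + (k - i) = k by lia.
  have -> : i + (k - i).-1 = k.-1 by lia.
  have -> : i + (m - i) = m by lia.
  apply; [lia|by rewrite lbE|move=> m' hm'; rewrite lbE; apply: gap; lia].
Qed.

Lemma evsat_size k (p : pr PS) : evsat S k p -> k <= size S.
Proof.
by case=> k0 [e [he _]]; have := onthTE S k.-1; case: (onth S k.-1) he => //= a _; lia.
Qed.

Lemma run_size k p nu rs : run compiled S k p nu rs ->
  rs = [::] \/ k + size rs <= (size S).+1.
Proof.
elim: rs k p nu => [|d rs IH] k p nu /=; first by left.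
by case=> _ _ /evsat_size h _ /IH [->|h']; right => /=; lia.
Qed.

Lemma asat_xcan n (a : atom Var PS) : 0 < i -> i + n <= size S ->
  asat (xcan (i + n)) a <->
  [/\ evsat S (i + n) a.1.1,
      csat (vshift (clkval n) (tm S (i + n) - tm S (i + n).-1)%R) a.1.2 &
      lb (i + n) = a.2].
Proof.
move=> i0 h; rewrite /asat /= addKn.
have := onthTE S (i + n).-1; rewrite /evsat.
case: (onth S (i + n).-1) => [[e t]|] /=; last lia.
move=> _; split=> -[h1 h2 h3]; split=> //; first by split; [lia|exists e].
by case: h1 => _ [e' [[->]]].
Qed.

(** The index [n.+1] places the run after its first transition, where every state is the code of a
    state of [N]. *)
Lemma run_path n q rs : 0 < i ->
  run compiled S (i + n.+1) (code q) (clkval n.+1) rs ->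
  map (@tlab _ _ _ _ PS) rs = map lb (iota (i + n.+1) (size rs)) ->
  exists s : nat -> st N, [/\ s (i + n.+1) = q,
    forall k, i + n.+1 <= k < i + n.+1 + size rs -> stp (s k) (xcan k) (s k.+1) &
    last (code q) (map (@tdst _ _ _ _ PS) rs) = code (s (i + n.+1 + size rs))].
Proof.
move=> i0; elim: rs n q => [|d rs IH] n q /=.
  by exists (fun=> q); split=> // k; lia.
case=> /in_delta [q1 [q2 [a [ia [->|[_ ->]]]]]] //= /code_inj e1 ev cs rn [la els].
subst q1; have sa : asat (xcan (i + n.+1)) a.
  by apply/(asat_xcan _ i0); [apply: evsat_size ev|].
rewrite la -addnS in rn; rewrite -addnS in els.
have [s [s1 s2 s3]] := IH n.+1 q2 rn els.
exists (fun k => if k == i + n.+1 then q else s k); split.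
- by rewrite eqxx.
- move=> k hk; have -> : (k.+1 == i + n.+1) = false by lia.
  have [ek|nk] := eqVneq k (i + n.+1); last by apply: s2; lia.
  rewrite ek -addnS s1; apply/alE; by exists a.
- have -> : (i + n.+1 + (size rs).+1 == i + n.+1) = false by lia.
  by rewrite s3; congr (code (s _)); lia.
Qed.

Lemma path_run n m (s : nat -> st N) : 0 < i -> i + n.+1 + m <= (size S).+1 ->
  (forall k, i + n.+1 <= k < i + n.+1 + m -> stp (s k) (xcan k) (s k.+1)) ->
  exists rs, [/\ size rs = m,
    run compiled S (i + n.+1) (code (s (i + n.+1))) (clkval n.+1) rs,
    map (@tlab _ _ _ _ PS) rs = map lb (iota (i + n.+1) m) &
    last (code (s (i + n.+1))) (map (@tdst _ _ _ _ PS) rs) = code (s (i + n.+1 + m))].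
Proof.
move=> i0; elim: m n => [|m IH] n hS h; first by exists [::]; rewrite addn0.
have [||rs [r1 r2 r3 r4]] := IH n.+1; first lia.
  by move=> k hk; apply: h; lia.
have /alE [a [ia sa]] := h (i + n.+1) ltac:(lia).
have [ev cs la] : [/\ evsat S (i + n.+1) a.1.1,
    csat (vshift (clkval n.+1) (tm S (i + n.+1) - tm S (i + n.+1).-1)%R) a.1.2 &
    lb (i + n.+1) = a.2] by apply/asat_xcan => //; lia.
exists (inner_trans (s (i + n.+1)) a (s (i + n.+1).+1) :: rs).
rewrite -!addnS /= r1 la r3; split=> //=; last by rewrite r4; congr (code (s _)); lia.
split=> //; last by rewrite -la -addnS.
  rewrite in_delta; exists (s (i + n.+1)), (s (i + n.+2)), a; split; last by left.
  by rewrite [i + n.+2]addnS.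
by rewrite -addnS.
Qed.

Lemma run_acc j : 0 < i <= j -> j <= size S ->
  (exists rs, [/\ size rs = (j - i).+1, run compiled S i 0 vundef rs,
     map (@tlab _ _ _ _ PS) rs = map lb (iota i (size rs)) &
     last 0 (map (@tdst _ _ _ _ PS) rs) \in tfinal compiled]) <-> acc N xcan i j.
Proof.
move=> hij jS; have i0 : 0 < i by lia.
have final q : (code q \in tfinal compiled) = fin q.
  by rewrite /= mem_map ?mem_enum //; apply: code_inj.
have asat0 a := asat_xcan (n := 0) a i0 ltac:(rewrite addn0; lia).
rewrite addn0 in asat0; split.
  case=> -[[] //|d rs] [/= [sz] [/in_delta [q1 [q2 [a [ia ed]]]] sd ev cs rn]].
  (* The run starts in state 0, so its first transition is a [first_trans]; the initial state [q1]
     behind it starts the path. *)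
  case: ed sd ev cs rn => [->|[iq ->]] //= _ ev cs rn [la els] lst.
  have sa : asat (xcan i) a by apply/asat0.
  have e1 : i + 1 = i.+1 by lia.
  have rn' : run compiled S (i + 1) (code q2) (clkval 1) rs by rewrite /= addn0 -la e1.
  rewrite -e1 in els; have [s [s1 s2 s3]] := run_path i0 rn' els.
  exists (fun k => if k == i then q1 else s k); split.
  - by rewrite eqxx.
  - have -> : (j.+1 == i) = false by lia.
    by rewrite -final; move: lst; rewrite s3 sz; have -> : i + 1 + (j - i) = j.+1 by lia.
  - move=> k hk; have -> : (k.+1 == i) = false by lia.
    have [ek|nk] := eqVneq k i; last by apply: s2; lia.
    by rewrite ek -e1 s1; apply/alE; exists a.
case=> s [si sf h].
have [||rs [r1 r2 r3 r4]] := @path_run 0 (j - i) s i0; first lia.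
  by move=> k hk; apply: h; lia.
have /alE [a [ia /asat0 [ev cs la]]] := h i ltac:(lia).
have e1 : i + 1 = i.+1 by lia.
exists (first_trans a (s i.+1) :: rs); split=> /=.
- by rewrite r1.
- split=> //; last by move: r2; rewrite /= addn0 la e1.
  by rewrite in_delta; exists (s i), (s i.+1), a; split=> //; right.
- by rewrite la r1 -e1 r3.
- by rewrite -e1 r4 final; have -> : i + 1 + (j - i) = j.+1 by lia.
Qed.

End Compile.

(** * Outputs of the compiled automaton *)

Section Output.
Variables (Ev Ty : Type) (Var : finType) (etype : Ev -> Ty) (PS : predsys etype).

Lemma out_mu i (rs : seq (trans Var PS)) X k :
  has (fun kd => (kd.1 == k) && (X \in tlab kd.2)) (zip (iota i (size rs)) rs) =
  (i <= k < i + size rs) && (X \in nth set0 (map (@tlab _ _ _ _ PS) rs) (k - i)).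
Proof.
elim: rs i => [|d rs IH] i /=; first by case: andP => // -[]; lia.
rewrite IH; have [->|ne] := eqVneq i k.
  rewrite subnn /= ltnn /= orbF leqnn; have -> : (k < k + (size rs).+1) by lia.
  by [].
have -> /= : (i < k < i.+1 + size rs) = (i <= k < i + (size rs).+1) by lia.
case h: (i <= k < _) => //=; have -> : k - i = (k - i.+1).+1 by lia.
by [].
Qed.

Lemma regular_compile (F : sprop Ev Var) : wfp F -> regular PS true true F ->
  exists A : tcea Var PS, [/\ tcea_wf A, sync_resets A &
    forall S, valid_stream S -> forall C, tcea_out A S C <-> F S C].
Proof.
move=> wF [L [[N HN] HL]].
(* Finite choice of one list of atoms for each pair of states. *)
have [al H] : exists al : st N * st N -> seq (atom Var PS), forall qq,
    (forall a, List.In a (al qq) -> ccond_wf a.1.2) /\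
    forall x, stp qq.1 x qq.2 <-> exists a, List.In a (al qq) /\ asat x a.
  apply: (fin_all_exists (P := fun (qq : st N * st N) (u : seq (atom Var PS)) =>
    (forall a, List.In a u -> ccond_wf a.1.2) /\
    forall x, stp qq.1 x qq.2 <-> exists a, List.In a u /\ asat x a)) => qq.
  exact: stpD.
pose al2 q q' := al (q, q').
have al_wf q q' a : List.In a (al2 q q') -> ccond_wf a.1.2 by apply: (H (q, q')).1.
have alE q q' x : stp q x q' <-> exists a, List.In a (al2 q q') /\ asat x a.
  exact: (H (q, q')).2.
exists (compiled al2); split; [exact: compiled_wf|exact: compiled_sync|].
move=> S vS C; split.
  case=> i [j [rs [ij sz rn lst eC]]].
  have jS : j <= size S.
    by case: (run_size rn) sz => [->|] //; lia.
  (* The default event for [xcan] is taken from the first step of the run, as [Ev] might be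
     empty. *)
  have [e0 _] : exists e0 : Ev, True.
    case: rs rn sz {lst eC} => [//|d rs] [_ _ [_ [e _]] _ _] _; by exists e.
  have wC : wfce S C.
    rewrite eC; split=> /= [|||X k]; [lia|lia|lia|rewrite out_mu sz; lia].
  have sC : cstart C = i by rewrite eC.
  have tC : cend C = j by rewrite eC.
  rewrite -(cutK wC) sC tC.
  pose lb := labs (cmu C).
  have cx : compat true true S (cmu C) (xcan S e0 i lb) i j.
    by apply: compat_xcan => //; lia.
  apply/(HL S vS _ _ _ _ ij jS cx)/HN; first lia.
  apply/(run_acc alE e0 lb ij jS); exists rs; split=> //.
  apply: (@eq_from_nth _ set0); rewrite !size_map ?size_iota // => k hk.
  rewrite (nth_map 0) ?size_iota // nth_iota //; apply/setP => X.
  by rewrite inE eC /= out_mu addKn; have -> : i <= i + k < i + size rs by lia.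
move=> FC; have wC := wF _ _ FC; have [w1 w2 w3 w4] := wC.
have [e0 _] : exists e0 : Ev, True.
  by case: S w3 {vS FC wC} => [|[e t] S] /= w3; [lia|exists e].
have ij : 0 < cstart C <= cend C by lia.
pose lb := labs (cmu C).
have cx : compat true true S (cmu C) (xcan S e0 (cstart C) lb) (cstart C) (cend C).
  exact: compat_xcan.
move: FC; rewrite -{1}(cutK wC) (HL S vS _ _ _ _ ij w3 cx) HN //.
case/(run_acc alE e0 lb ij w3) => rs [sz rn lr lst].
exists (cstart C), (cend C), rs; split=> //.
apply: ce_ext => //= X k; rewrite out_mu lr.
case h: (cstart C <= k < cstart C + size rs) => /=; last first.
  by apply/negP => /w4; lia.
rewrite (nth_map 0) ?size_iota ?nth_iota; [|lia|lia].
by rewrite inE; congr (cmu C X _); lia.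
Qed.

End Output.

Theorem theorem4 (Ev Ty : Type) (Var : finType) (tv : Ty -> Var)
    (tv_inj : injective tv) (etype : Ev -> Ty) (PS : predsys etype)
    (phi : tform Var PS) :
  windowed phi ->
  exists A : tcea Var PS,
    [/\ tcea_wf A, sync_resets A &
        forall S : stream Ev, valid_stream S ->
          forall C : ce Var, tcea_out A S C <-> sem tv S phi C].
Proof.
by move=> /(regular_windowed tv) R; apply: regular_compile R; apply: sem_wf.
Qed.
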